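(* Let $R$ be a commutative ring with one and let $n\in\mathbb{N}$. Given the coefficients of a bivariate polynomial $p\in R[X,Y]$ with $\deg_X(p)<n$ and $\deg_Y(p)<n$, and given $n^2$ arguments $(x_k,y_k)\in R^2$, $0\le k<n^2$, the $n^2$ values $p(x_k,y_k)$ can be computed using at most $\mathcal{O}(n^3\cdot\log^2 n\cdot\log\log n)$ arithmetic operations in $R$.
   Context: Complexity is measured by the number of arithmetic operations (additions, subtractions, multiplications, and divisions where defined) in the ring $R$ performed by an algorithm that receives the coefficients and the points as input. *)

(* Defs.v *)
From mathcomp Require Import all_boot all_order all_algebra.
From mathcomp Require Import reals exp.

Set Implicit Arguments.
Unset Strict Implicit.
Unset Printing Implicit Defensive.

Import GRing.Theory Num.Theory.
Local Open Scope ring_scope.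

(* Straight-line programs over a commutative ring. A memory is a sequence of
   ring elements; the instruction (o, i, j) applies the arithmetic operation o
   to the cells i and j and appends the result as a new last cell. *)
Inductive arith_op := Add | Sub | Mul | Div.

Definition instr : Type := arith_op * nat * nat.

(* A division is defined exactly when the divisor is a unit; this is stated
   with an explicit inverse because a comNzRingType has no inverse function. *)
Definition op_result (R : comNzRingType) (o : arith_op) (a b c : R) : Prop :=
  match o with
  | Add => c = a + b
  | Sub => c = a - b
  | Mul => c = a * b
  | Div => exists2 b' : R, b * b' = 1 & c = a * b'
  end.

Inductive exec (R : comNzRingType) : seq instr -> seq R -> seq R -> Prop :=
| exec_nil m : exec [::] m m
| exec_cons o i j is_ m m' c :
    (i < size m)%N -> (j < size m)%N -> op_result o m`_i m`_j c ->
    exec is_ (rcons m c) m' ->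
    exec ((o, i, j) :: is_) m m'.

Record slp := Slp { code : seq instr; outputs : seq nat }.

(* Every instruction is one arithmetic operation; reading an input and
   designating an output cell are free. *)
Definition op_count (P : slp) : nat := size (code P).

(* The initial memory holds the constants 0 and 1 followed by the inputs; no
   other ring constants are available to a program. *)
Definition slp_computes (R : comNzRingType) (P : slp) (inp out : seq R) : Prop :=
  exists m : seq R,
    [/\ exec (code P) [:: 0, 1 & inp] m,
        all (fun k => k < size m)%N (outputs P)
      & [seq m`_k | k <- outputs P] = out].

(* In {poly {poly R}} the outer variable is X and the inner one is Y, as in
   polyXY, so the coefficient of X^i Y^j is p`_i`_j. *)
Definition coefs2 (R : comNzRingType) (n : nat) (p : {poly {poly R}}) : seq R :=
  [seq p`_i`_j | i <- iota 0 n, j <- iota 0 n].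

Definition points2 (R : comNzRingType) (pts : seq (R * R)) : seq R :=
  flatten [seq [:: q.1; q.2] | q <- pts].

(* The strict degree bounds deg_X p < n and deg_Y p < n (with deg 0 = -oo) read
   size p <= n and sizeY p <= n, sizes being degrees plus one. *)
Definition bivariate_multipoint_eval (R : comNzRingType) (n : nat) (P : slp) :
    Prop :=
  forall (p : {poly {poly R}}) (pts : (n ^ 2)%N.-tuple (R * R)),
    (size p <= n)%N -> (sizeY p <= n)%N ->
    slp_computes P (coefs2 n p ++ points2 pts) [seq p.[q.1, q.2] | q <- pts].

Definition log2 (K : realType) (x : K) : K := ln x / ln 2.

(* Main.v *)
(* For each power of Y, the coefficient polynomial in X is evaluated at all the
   x_k, in blocks of about n points; the powers of the y_k are then brought in by
   Horner's rule.  The points of a block are shared by n polynomials, so what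
   depends on the points only may be computed naively, in O(n^2 log n) operations
   per block: the subproduct tree of the polynomials 1 - x_k X, and the inverse
   modulo X^n of its root.  If f' is the reversal of f, the value f(x_k) is the
   coefficient of X^(n-1) in f' / (1 - x_k X); going down the tree from
   f' / prod_k (1 - x_k X), each step multiplies by the polynomial of the sibling,
   and only the leading coefficients need to be kept.  No division is performed.

   Polynomials of degree less than N over any commutative ring are multiplied with
   O(N log N log log N) operations, following Schoenhage-Strassen and
   Cantor-Kaltofen: modulo 1 + X^(r^k) + ... + X^((r-1) r^k) the variable is a root
   of unity of order r^(k+1), and splitting k into halves reduces a product to
   about 2 r^(k/2) products of half the size (in k) by a radix-r Fourier transform.
   This yields r^s times the product; r = 2 and r = 3 together give the product.

   Straight-line programs are run once and for all in the ring of functions from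
   input values to R, where computing a set of elements does not depend on any
   particular input. *)

From HB Require Import structures.
Require Import Defs.
From mathcomp Require Import all_boot all_order all_algebra qpoly.
From mathcomp Require Import boolp classical_sets functions reals exp.
From mathcomp Require Import zify ring lra.

Set Implicit Arguments.
Unset Strict Implicit.
Unset Printing Implicit Defensive.

Import Order.TTheory GRing.Theory Num.Theory.
Local Open Scope ring_scope.
Local Open Scope classical_set_scope.

(** * Straight-line computability *)

Section Computability.
Variable F : comNzRingType.
Implicit Types (U V W : set F) (c d : nat).

(** A program starts with 0 and 1 in memory, so these two are always at hand. *)
Definition avail U : set F := U `|` [set 0; 1].

(** The memory is abstracted to a set of ring elements, so that no cell addresses have to be
    tracked. The number [c] is only an upper bound, and [V] may be infinite as long as all of it
    ends up available. *)
Inductive computes : nat -> set F -> set F -> Prop :=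
| computes_done c U V : V `<=` avail U -> computes c U V
| computes_step c U V a b z : avail U a -> avail U b ->
    z = a + b \/ z = a - b \/ z = a * b -> computes c (z |` U) V -> computes c.+1 U V.

Lemma sub_avail U : U `<=` avail U. Proof. by move=> z; left. Qed.

Lemma avail_avail U V : U `<=` avail V -> avail U `<=` avail V.
Proof. by move=> UV z [/UV//|z01]; right. Qed.

Lemma availS U V : U `<=` V -> avail U `<=` avail V.
Proof. by move=> UV; apply: avail_avail => z /UV; left. Qed.

Lemma computes_mono c d U U' V V' : computes c U V -> (c <= d)%N ->
  U `<=` avail U' -> V' `<=` V `|` avail U' -> computes d U' V'.
Proof.
move=> H; elim: H d U' V' => {c U V} [c U V VU|c U V a b z Ua Ub zab _ IH] d U' V' cd UU VV.
  apply: computes_done => z /VV [/VU|//]; exact: avail_avail.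
case: d cd => // d cd; apply: (computes_step (a := a) (b := b) (z := z)).
- exact: avail_avail Ua.
- exact: avail_avail Ub.
- by [].
apply: IH => //.
  by move=> t [->|/UU]; [left; left|apply: availS => ?; right].
by move=> t /VV [|Ht]; [left|right; apply: availS Ht => ?; right].
Qed.

Lemma computes_trans c d U V W : computes c U V -> computes d (U `|` V) W ->
  computes (c + d) U (V `|` W).
Proof.
move=> H; elim: H d W => {c U V} [c U V VU|c U V a b z Ua Ub zab _ IH] d W HW.
  apply: computes_mono HW _ _ _; first exact: leq_addl.
    by move=> t [|/VU//]; left.
  by move=> t [/VU|]; [right|left].
rewrite addSn; apply: (computes_step Ua Ub zab); apply: IH.
apply: computes_mono HW _ _ _ => //.
  by move=> t [Ut|Vt]; left; [left; right|right].
Qed.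

Lemma computes_seq c d e U V W : computes c U V -> computes d (U `|` V) W -> (c + d <= e)%N ->
  computes e U W.
Proof.
move=> H1 H2 le; apply: computes_mono (computes_trans H1 H2) le _ _.
  exact: sub_avail.
by move=> t; left; right.
Qed.

Lemma computes_pair c d e U V W : computes c U V -> computes d U W -> (c + d <= e)%N ->
  computes e U (V `|` W).
Proof.
move=> H1 H2 le.
have K : computes d (U `|` V) W by apply: computes_mono H2 _ _ _ => // t ?; left=> //; left.
apply: computes_mono (computes_trans H1 K) le _ _; first exact: sub_avail.
by move=> t; left.
Qed.

(* The i-th stage may use the results of all the previous ones. *)
Lemma computes_iter m c U (V : nat -> set F) :
  (forall i, (i < m)%N -> computes c (U `|` \bigcup_(l in `I_i) V l) (V i)) ->
  computes (m * c) U (\bigcup_(i in `I_m) V i).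
Proof.
elim: m => [|m IH] H; first by apply: computes_done => z [].
have /computes_trans K : computes (m * c) U (\bigcup_(i in `I_m) V i).
  by apply: IH => i im; apply: H; rewrite ltnS ltnW.
apply: computes_mono (K _ _ (H m (ltnSn m))) _ _ _ => //; first by rewrite mulSn addnC.
  exact: sub_avail.
move=> z [i /=]; rewrite ltnS leq_eqVlt => /orP[/eqP ->|im] Vz; left.
  by right.
by left; exists i.
Qed.

Lemma computes_bigcup m c U (V : nat -> set F) :
  (forall i, (i < m)%N -> computes c U (V i)) ->
  computes (m * c) U (\bigcup_(i in `I_m) V i).
Proof.
move=> H; apply: computes_iter => i /H K.
by apply: computes_mono K _ _ _ => // z; left=> //; left.
Qed.

(** For independent stages whose results are only known to exist: choice fixes all of them first,
    with [x0] outside the range. *)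
Lemma computes_choice m c U (X : Type) (V : X -> set F) (Q : nat -> X -> Prop) (x0 : X) :
  (forall i, (i < m)%N -> exists x, computes c U (V x) /\ Q i x) ->
  exists x : nat -> X, computes (m * c) U (\bigcup_(i in `I_m) V (x i)) /\
    forall i, (i < m)%N -> Q i (x i).
Proof.
move=> H; have /choice[x Hx] : forall i, exists x, (i < m)%N -> computes c U (V x) /\ Q i x.
  move=> i; case: (boolP (i < m)%N) => [/H [x Hx]|_]; first by exists x.
  by exists x0.
exists x; split; last by move=> i /Hx [].
by apply: computes_bigcup => i /Hx [].
Qed.

Lemma computes_op U a b z : avail U a -> avail U b ->
  z = a + b \/ z = a - b \/ z = a * b -> computes 1 U [set z].
Proof.
move=> Ua Ub zab; apply: (computes_step Ua Ub zab); apply: computes_done.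
by move=> t ->; left; left.
Qed.

Lemma computes_sum m U (g : nat -> F) :
  (forall i, (i < m)%N -> avail U (g i)) -> computes m U [set \sum_(i < m) g i].
Proof.
elim: m => [|m IH] H.
  by apply: computes_done => z ->; rewrite big_ord0; right; left.
apply: (@computes_seq m 1 _ _ [set \sum_(i < m) g i]); last by rewrite addn1.
  by apply: IH => i im; apply: H; rewrite ltnS ltnW.
apply: (@computes_op _ (\sum_(i < m) g i) (g m)); last by left; rewrite big_ord_recr.
  by left; right.
by apply: availS (H _ (ltnSn m)) => z; left.
Qed.

Lemma computes_dot m U (g h : nat -> F) :
  (forall i, (i < m)%N -> avail U (g i)) -> (forall i, (i < m)%N -> avail U (h i)) ->
  computes (m * 2) U [set \sum_(i < m) g i * h i].
Proof.
move=> Hg Hh.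
apply: (@computes_seq (m * 1) m _ _ (\bigcup_(i in `I_m) [set g i * h i])).
- apply: computes_bigcup => i im; apply: (computes_op (Hg _ im) (Hh _ im)).
  by right; right.
- by apply: (@computes_sum m _ (fun i => g i * h i)) => i im; left; right; exists i.
- lia.
Qed.

Definition vset N (v : nat -> F) : set F := [set v i | i in `I_N].
Definition mset m N (A : nat -> nat -> F) : set F := \bigcup_(u in `I_m) vset N (A u).

Lemma vsetP N v i : (i < N)%N -> vset N v (v i). Proof. by exists i. Qed.

Lemma msetP m N A u i : (u < m)%N -> (i < N)%N -> mset m N A (A u i).
Proof. by exists u => //; exists i. Qed.

Lemma computes_vset N c U v : (forall i, (i < N)%N -> computes c U [set v i]) ->
  computes (N * c) U (vset N v).
Proof.
move=> H; apply: computes_mono (computes_bigcup H) _ _ _ => //; first exact: sub_avail.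
by move=> z [i im <-]; left; exists i.
Qed.

End Computability.

Arguments computes {F} c%_N (U V)%_classical_set_scope.
Arguments vset {F} N%_N v _.
Arguments mset {F} (m N)%_N A _.

(** * Radix-r fast Fourier products *)

Lemma sum_blocks (V : nmodType) r m (f : nat -> V) :
  \sum_(i < r * m) f i = \sum_(l < r) \sum_(u < m) f (u + m * l)%N.
Proof.
elim: r => [|r IH]; first by rewrite mul0n !big_ord0.
rewrite mulSnr big_split_ord big_ord_recr /= IH; congr (_ + _).
by apply: eq_bigr => u _; rewrite addnC mulnC.
Qed.

(** * Congruences modulo a principal ideal *)

Section Congruence.
Variable R : comNzRingType.
Implicit Types M p q : R.

Definition cong M p q := exists Q, p = q + Q * M.

Lemma cong_refl M p : cong M p p. Proof. by exists 0; rewrite mul0r addr0. Qed.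

Lemma cong_trans M q p s : cong M p q -> cong M q s -> cong M p s.
Proof. by move=> [P ->] [Q ->]; exists (Q + P); rewrite -addrA mulrDl. Qed.

Lemma congM M p q p' q' : cong M p q -> cong M p' q' -> cong M (p * p') (q * q').
Proof.
move=> [P ->] [Q ->]; exists (q * Q + P * q' + P * Q * M); ring.
Qed.

Lemma cong_sum M n (p q : nat -> R) : (forall i, (i < n)%N -> cong M (p i) (q i)) ->
  cong M (\sum_(i < n) p i) (\sum_(i < n) q i).
Proof.
elim: n => [|n IH] H; first by rewrite !big_ord0; apply: cong_refl.
have /IH[P HP] : forall i, (i < n)%N -> cong M (p i) (q i).
  by move=> i im; apply: H; rewrite ltnS ltnW.
have [Q HQ] := H n (ltnSn n); rewrite !big_ord_recr /= HP HQ.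
exists (P + Q); ring.
Qed.

(** This glues residues as in the Chinese remainder theorem without inverting anything: an [e] that
    annihilates [M] modulo [M'] absorbs the error term, a multiple of [M]. *)
Lemma congZ M e M' p q : cong M p q -> cong M' (e * M) 0 -> cong M' (e * p) (e * q).
Proof.
move=> [Q ->] [Q' E]; exists (Q * Q'); move: E; rewrite add0r => E.
rewrite mulrDr -mulrA -E; ring.
Qed.

End Congruence.

(* A vector [v] of length [N] stands for the element [\sum_i v_i y^i] of an
   [F]-algebra where [y^N = 1]; multiplying it by a power of [y] is a rotation
   of its entries, hence free of arithmetic operations. *)
Section Vectors.
Variables (F B : comNzRingType) (phi : {rmorphism F -> B}).
Variables (N : nat) (y : B).
Hypotheses (N_gt0 : (0 < N)%N) (yN : y ^+ N = 1).

Definition vval (v : nat -> F) : B := \sum_(i < N) phi (v i) * y ^+ i.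

(** [i + N.-1] is [i - 1] modulo [N]: one step moves the entries up by one place, cyclically, as
    multiplication by [y] does. *)
Definition vrot t (v : nat -> F) : nat -> F :=
  iter t (fun w i => w ((i + N.-1) %% N)%N) v.

Lemma vrot_in t v i : (i < N)%N -> vset N v (vrot t v i).
Proof.
elim: t i => [|t IH] i iN; first exact: vsetP.
by apply: IH; rewrite ltn_pmod.
Qed.

Lemma vval_rot t v : vval (vrot t v) = y ^+ t * vval v.
Proof.
elim: t => [|t IH]; first by rewrite mul1r.
rewrite exprS -mulrA -IH /= /vval; move: (vrot t v) => {t IH v} w.
case: N N_gt0 yN => // n _ yn.
rewrite big_ord_recl big_ord_recr /= mulrDr addrC; congr (_ + _).
  rewrite mulr_sumr; apply: eq_bigr => i _; rewrite /bump /= add1n exprS.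
  rewrite addSnnS modnDr modn_small; last by rewrite ltnS ltnW.
  by rewrite mulrCA.
by rewrite add0n modn_small // mulrCA -exprS yn expr0.
Qed.

Lemma vval_sum m (g : nat -> nat -> F) :
  vval (fun i => \sum_(l < m) g l i) = \sum_(l < m) vval (g l).
Proof.
rewrite /vval exchange_big /=; apply: eq_bigr => i _.
by rewrite rmorph_sum mulr_suml.
Qed.

Lemma computes_rotsum U m (t : nat -> nat) (g : nat -> nat -> F) :
  (forall l, (l < m)%N -> vset N (g l) `<=` avail U) ->
  computes (N * m) U (vset N (fun i => \sum_(l < m) vrot (t l) (g l) i)).
Proof.
move=> H; apply: computes_vset => i iN.
by apply: (@computes_sum _ m U (fun l => vrot (t l) (g l) i)) => l lm; apply: (H l lm); apply: vrot_in.
Qed.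

Definition vpoly m (A : nat -> nat -> F) : {poly B} :=
  \sum_(u < m) (vval (A u))%:P * 'X^u.

Lemma vpoly_blocks r m A :
  vpoly (r * m) A = \sum_(l < r) vpoly m (fun u => A (u + m * l)%N) * 'X^(m * l).
Proof.
rewrite /vpoly (sum_blocks r m (fun u => (vval (A u))%:P * 'X^u)).
apply: eq_bigr => l _; rewrite mulr_suml; apply: eq_bigr => u _.
by rewrite exprD mulrA.
Qed.

Lemma size_vpoly m A : (size (vpoly m A) <= m)%N.
Proof.
apply: (leq_trans (size_sum _ _ _)); apply/bigmax_leqP => u _.
rewrite mul_polyC; apply: leq_trans (size_scale_leq _ _) _.
by rewrite size_polyXn ltn_ord.
Qed.

End Vectors.

Section FastProduct.
Variables (F B : comNzRingType) (phi : {rmorphism F -> B}) (r b : nat) (y : B).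
Let N := (r ^ b.+1)%N.
Let z := y ^+ (r ^ b).
Hypotheses (r_gt1 : (1 < r)%N) (zr : z ^+ r = 1).
(** The exponent [r.-1] stands for -1, since [z ^+ r = 1]. Together with [zr], this orthogonality
    relation is all that is asked of [z] as a root of unity of order [r]. *)
Hypothesis z_sum : forall l, (0 < l < r)%N -> \sum_(j < r) z ^+ (r.-1 * (j * l)) = 0.
Variables (s T : nat).
Notation vval := (vval phi N y).
Notation vpoly := (vpoly phi N y).
(** The recursive multiplication of vectors. The factor [r ^ s] is tolerated because [r] may fail to
    be invertible. *)
Hypothesis mulT : forall v w : nat -> F,
  exists c, computes T (vset N v `|` vset N w) (vset N c) /\
            vval c = r%:R ^+ s * (vval v * vval w).

Let N_gt0 : (0 < N)%N. Proof. by rewrite expn_gt0 ltnW. Qed.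

Let yN : y ^+ N = 1. Proof. by rewrite /N expnSr exprM. Qed.

(** The exponent [N.-1] inverts powers of [y]. After exchanging the sums, the terms with [l > 0]
    vanish by orthogonality, and [l = 0] contributes 1 for each [j]. *)
Lemma cyclic_idempotent_sum m e :
  \sum_(j < r) \sum_(l < r) (y ^+ (N.-1 * ((e + j * r ^ b) * l)))%:P * 'X^(m * l)
  = r%:R :> {poly B}.
Proof.
have r_gt0 : (0 < r)%N by apply: ltnW.
rewrite exchange_big /= (bigD1 (Ordinal r_gt0)) //= [X in _ + X]big1 ?addr0.
  transitivity (\sum_(j < r) (1 : {poly B})); last by rewrite sumr_const card_ord.
  by apply: eq_bigr => j _; rewrite !muln0 !expr0 mulr1.
move=> l l0; rewrite -mulr_suml -rmorph_sum /=.
rewrite (_ : \sum_(j < r) _ = y ^+ (N.-1 * (e * l)) * \sum_(j < r) z ^+ (r.-1 * (j * l))).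
  rewrite z_sum ?mulr0 ?mul0r // ltn_ord andbT lt0n.
  by apply: contraNneq l0 => E; apply/eqP/val_inj.
rewrite mulr_sumr; apply: eq_bigr => j _.
rewrite mulnDl mulnDr exprD; congr (_ * _).
(* [N] is a multiple of [r], so both exponents are -1 modulo [r]. *)
have zN : z ^+ N.-1 = z ^+ r.-1.
  have -> : N.-1 = (r.-1 + r * (r ^ b).-1)%N.
    have : (0 < r ^ b)%N by rewrite expn_gt0 r_gt0.
    by rewrite /N expnS; case: (r ^ b)%N => // q _; rewrite mulnS /=; lia.
  by rewrite exprD exprM zr expr1n mulr1.
by rewrite [in RHS]exprM -zN -exprM -exprM; congr (y ^+ _); lia.
Qed.

(* Splitting [X^(rm) - w^r] into the factors [X^m - w z^j]: the elements [E_j]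
   below satisfy [E_j (X^m - w z^j) = 0] modulo [X^(rm) - w^r] and add up to [r],
   so they glue the products modulo the factors. *)
Lemma fast_product a e (A A' : nat -> nat -> F) : (a <= b.+1)%N ->
  exists C, computes (r ^ a * T + 3 * a * r ^ a.+1 * N)
                 (mset (r ^ a) N A `|` mset (r ^ a) N A') (mset (r ^ a) N C) /\
    cong ('X^(r ^ a) - (y ^+ (r ^ a * e))%:P) (vpoly (r ^ a) C)
      (r%:R ^+ (s + a) * (vpoly (r ^ a) A * vpoly (r ^ a) A')).
Proof.
have r_gt0 : (0 < r)%N by apply: ltnW.
elim: a e A A' => [|a IH] e A A' ab.
  have [c [Hc Ec]] := mulT (A 0%N) (A' 0%N).
  exists (fun=> c); split.
    apply: computes_mono Hc _ _ _; first by lia.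
      by move=> t [H|H]; left; [left|right]; exists 0%N.
    by move=> t [u _ H]; left.
  exists 0; rewrite mul0r addr0 addn0 /vpoly expn0 !big_ord1 !expr0 !mulr1.
  by rewrite Ec !rmorphM rmorphXn rmorph_nat.
set m := (r ^ a)%N.
have m_gt0 : (0 < m)%N by rewrite expn_gt0 r_gt0.
(* The factors are [X^m - y^(t j)], where [y^(t j) = y^(m e) z^j]. As [a <= b], each [t j] is a
   multiple of [m], which puts the factor in the form of the induction hypothesis. *)
pose t j := (m * e + j * r ^ b)%N.
have tE j : t j = (m * (e + j * r ^ (b - a)))%N.
  by rewrite /t mulnDr mulnCA -expnD subnKC.
(* Reduction modulo [X^m - y^(t j)]: the block of index [l] is multiplied by [y^(t j * l)], a
   rotation, and the blocks are added. *)
pose red (A0 : nat -> nat -> F) j u i : F := \sum_(l < r) vrot N (t j * l) (A0 (u + m * l)%N) i.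
have red_comp A1 j : (j < r)%N -> computes (m * (N * r)) (mset (r * m) N A1) (mset m N (red A1 j)).
  move=> jr; apply: computes_bigcup => u um.
  apply: (@computes_rotsum _ _ N_gt0 _ r (fun l => t j * l)%N (fun l => A1 (u + m * l)%N)).
  move=> l lr p Hp; left; exists (u + m * l)%N => //=.
  by apply: leq_trans (_ : m * l.+1 <= _)%N; [lia|rewrite mulnC leq_mul2r lr orbT].
have red_cong A1 j : cong ('X^m - (y ^+ t j)%:P) (vpoly m (red A1 j)) (vpoly (r * m) A1).
  rewrite vpoly_blocks.
  have -> : vpoly m (red A1 j) = \sum_(l < r) vpoly m (fun u => A1 (u + m * l)%N) * (y ^+ (t j))%:P ^+ l.
    under [RHS]eq_bigr do rewrite mulr_suml.
    rewrite exchange_big; apply: eq_bigr => u _ /=.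
    rewrite (vval_sum phi N y r (fun l => vrot N (t j * l) (A1 (u + m * l)%N))).
    rewrite rmorph_sum mulr_suml; apply: eq_bigr => l _ /=.
    by rewrite vval_rot // rmorphM /= exprM rmorphXn /=; ring.
  apply: (@cong_sum _ _ r (fun l => vpoly m (fun u => A1 (u + m * l)%N) * (y ^+ (t j))%:P ^+ l)
    (fun l => vpoly m (fun u => A1 (u + m * l)%N) * 'X^(m * l))) => l lr.
  apply: congM; first exact: cong_refl.
  exists (- (\sum_(i < l) 'X^m ^+ (l.-1 - i) * (y ^+ t j)%:P ^+ i)).
  rewrite mulNr [_ * (_ - _)]mulrC -subrXX exprM; ring.
have {}IH j : (j < r)%N -> exists C,
    computes (m * T + 3 * a * r ^ a.+1 * N) (mset m N (red A j) `|` mset m N (red A' j)) (mset m N C) /\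
    cong ('X^m - (y ^+ t j)%:P) (vpoly m C)
      (r%:R ^+ (s + a) * (vpoly m (red A j) * vpoly m (red A' j))).
  move=> _; have [|C HC] := IH (e + j * r ^ (b - a))%N (red A j) (red A' j).
    by apply: ltnW.
  by exists C; rewrite tE.
have [|Cj [HC1 HC2]] := @computes_choice F r (2 * (m * (N * r)) + (m * T + 3 * a * r ^ a.+1 * N))
  (mset (r * m) N A `|` mset (r * m) N A') _ (mset m N)
  (fun j C => cong ('X^m - (y ^+ t j)%:P) (vpoly m C)
      (r%:R ^+ (s + a) * (vpoly m (red A j) * vpoly m (red A' j)))) (fun=> fun=> 0).
  move=> j jr; have [C [HC EC]] := IH j jr; exists C; split=> //.
  apply: (@computes_seq _ (2 * (m * (N * r))) (m * T + 3 * a * r ^ a.+1 * N) _ _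
    (mset m N (red A j) `|` mset m N (red A' j))) => //.
    apply: (@computes_pair _ (m * (N * r)) (m * (N * r))); last by lia.
      by apply: computes_mono (red_comp A j jr) _ _ _ => // q Hq; left => //; left.
    by apply: computes_mono (red_comp A' j jr) _ _ _ => // q Hq; left => //; right.
  by apply: computes_mono HC _ _ _ => // q Hq; left => //; right.
(* For [w = u + m l], this is the coefficient of [X^w] in the sum of the [E_j] times the [j]-th
   product; the rotation multiplies by [y^(- t j * l)]. *)
pose C w i : F := \sum_(j < r) vrot N (N.-1 * (t j * (w %/ m))) (Cj j (w %% m)%N) i.
exists C; rewrite expnS -/m; split.
  apply: (computes_seq HC1 (d := (r * m) * (N * r))).
    apply: computes_bigcup => w wm.
    apply: (@computes_rotsum _ _ N_gt0 _ r (fun j => N.-1 * (t j * (w %/ m)))%N (fun j => Cj j (w %% m)%N)).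
    by move=> j jr p Hp; left; right; exists j => //; exists (w %% m)%N => //=; rewrite ltn_pmod.
  (* The two reductions and the gluing cost [r^(a+2) N] additions each, which accounts for the
     factor 3. *)
  rewrite !expnS -/m; nia.
pose E j : {poly B} := \sum_(l < r) (y ^+ (N.-1 * (t j * l)))%:P * 'X^(m * l).
have -> : vpoly (r * m) C = \sum_(j < r) E j * vpoly m (Cj j).
  rewrite vpoly_blocks.
  under [RHS]eq_bigr do rewrite mulr_suml.
  rewrite exchange_big; apply: eq_bigr => l _ /=.
  under [RHS]eq_bigr do rewrite mulr_sumr.
  rewrite exchange_big mulr_suml; apply: eq_bigr => u _ /=.
  rewrite [X in X%:P](_ : _ = \sum_(j < r) y ^+ (N.-1 * (t j * l)) * vval (Cj j u)).
    by rewrite rmorph_sum !mulr_suml; apply: eq_bigr => j _; rewrite rmorphM /=; ring.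
  rewrite (vval_sum phi N y r (fun j => vrot N (N.-1 * (t j * ((u + m * l) %/ m))) (Cj j ((u + m * l) %% m)%N))).
  apply: eq_bigr => j _; rewrite vval_rot //.
  have -> : (u + m * l = l * m + u)%N by lia.
  by rewrite divnMDl // divn_small // addn0 modnMDl modn_small.
have -> : r%:R ^+ (s + a.+1) * (vpoly (r * m) A * vpoly (r * m) A') =
   \sum_(j < r) E j * (r%:R ^+ (s + a) * (vpoly (r * m) A * vpoly (r * m) A')).
  rewrite -mulr_suml; rewrite /E (cyclic_idempotent_sum m (m * e)) addnS exprS; ring.
apply: (@cong_sum _ _ r (fun j => E j * vpoly m (Cj j))
  (fun j => E j * (r%:R ^+ (s + a) * (vpoly (r * m) A * vpoly (r * m) A')))) => j jr.
have Ej0 : cong ('X^(r * m) - (y ^+ (r * m * e))%:P) (E j * ('X^m - (y ^+ t j)%:P)) 0.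
  (* [q] is the inverse of [w], and [E j] is a geometric sum of ratio [q X^m]. Hence
     [E j * (X^m - w)] telescopes to [w ((q X^m)^r - 1) = w q^r (X^(r m) - w^r)]. *)
  pose q : {poly B} := (y ^+ (N.-1 * t j))%:P.
  pose w : {poly B} := (y ^+ t j)%:P.
  have qw : q * w = 1.
    rewrite -rmorphM /= -exprD -mulSnr prednK //.
    by rewrite exprM yN expr1n.
  exists (w * q ^+ r); rewrite add0r.
  have -> : E j = \sum_(l < r) (q * 'X^m) ^+ l.
    by apply: eq_bigr => l _; rewrite exprMn -rmorphXn -!exprM /= mulnA.
  have wr : w ^+ r = (y ^+ (r * m * e))%:P.
    rewrite -rmorphXn -exprM /=.
    have -> : (t j * r = r * m * e + N * j)%N by rewrite /t /N expnS; lia.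
    by rewrite exprD [y ^+ (N * j)]exprM yN expr1n mulr1.
  have -> : 'X^m - (y ^+ t j)%:P = w * (q * 'X^m - 1).
    by rewrite mulrBr mulr1 mulrA [w * q]mulrC qw mul1r.
  rewrite mulrCA [_ * (_ - 1)]mulrC -subrX1 -wr -mulrA; congr (_ * _).
  rewrite exprMn mulrBr -[q ^+ r * w ^+ r]exprMn qw expr1n -exprM [(m * r)%N]mulnC //.
apply: congZ Ej0.
apply: cong_trans (HC2 j jr) _; apply: congM; first exact: cong_refl.
by apply: congM; apply: red_cong.
Qed.

End FastProduct.

(** * Products modulo a cyclotomic polynomial *)

(** Schoolbook multiplication, with the powers of [y] absorbed by rotations; it is the base of the
    recursion, where [N <= r^2]. *)
Lemma naive_product (F B : comNzRingType) (phi : {rmorphism F -> B}) N (y : B)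
    (v w : nat -> F) : (0 < N)%N -> y ^+ N = 1 ->
  exists c, computes (N * (N * 2)) (vset N v `|` vset N w) (vset N c) /\
    vval phi N y c = vval phi N y v * vval phi N y w.
Proof.
move=> N_gt0 yN; exists (fun i => \sum_(u < N) v u * vrot N u w i); split.
  apply: computes_vset => i iN; apply: (@computes_dot _ N _ v (fun u => vrot N u w i)).
    by move=> u uN; left; left; apply: vsetP.
  by move=> u uN; left; right; apply: vrot_in.
rewrite (vval_sum phi N y N (fun u i => v u * vrot N u w i)) [in RHS]/vval mulr_suml.
apply: eq_bigr => u _; rewrite -mulrA -vval_rot // /vval mulr_sumr.
by apply: eq_bigr => i _; rewrite rmorphM mulrA.
Qed.

(** When the powers of [z] below [n] add up to 0 and [z^n = 1], the right-hand side is [- n]: this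
    exhibits [n] as a multiple of [1 - z]. *)
Lemma arith_geometric_sum (R : comNzRingType) (z : R) n :
  (1 - z) * (\sum_(t < n) z ^+ t *+ t) = \sum_(t < n) z ^+ t - z ^+ n *+ n + z ^+ n - 1.
Proof.
elim: n => [|n IH]; first by rewrite !big_ord0 expr0; ring.
rewrite big_ord_recr /= mulrDr {}IH big_ord_recr /= exprS -mulr_natr -(mulr_natr (z * z ^+ n)) -natr1.
ring.
Qed.

(** Zero divisors cannot cancel a monic leading coefficient, so degrees add up in [Q * M]. *)
Lemma small_multiple_eq0 (R : comNzRingType) (Q M : {poly R}) :
  M \is monic -> (size (Q * M)%R < size M)%N -> Q = 0.
Proof.
move=> Mm; case: (eqVneq Q 0) => // Q0.
rewrite size_Mmonic // => H; move: Q0; rewrite -size_poly_eq0; lia.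
Qed.

Section CyclotomicProduct.
Variable r : nat.
Hypothesis r_gt1 : (1 < r)%N.
(** This holds for a prime [r], since multiplication by [l] then permutes the residues modulo [r];
    it is applied to 2 and 3. *)
Hypothesis root_sums : forall (B : comNzRingType) (z : B), \sum_(i < r) z ^+ i = 0 ->
  forall l, (0 < l < r)%N -> \sum_(j < r) z ^+ (r.-1 * (j * l)) = 0.

(* With [k = a + b] and [y = x^(r^a)], an element is a polynomial of degree less
   than [r^a] in [x] over the ring generated by [y].  The product of two of them
   has degree less than [2 r^a], so it is determined by its residues modulo
   [X^(r^a) - 1] and [X^(r^a) - z], where [z = y^(r^b)]. *)
Lemma cyclotomic_product j k : (k <= 2 ^ j)%N ->
  exists s, (s <= 2 ^ j.+1)%N /\
  forall (F B : comNzRingType) (phi : {rmorphism F -> B}) (x : B), \sum_(i < r) (x ^+ (r ^ k)) ^+ i = 0 ->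
  forall v w : nat -> F,
  exists c, computes (8 * r ^ 3 * (r ^ k * (2 ^ j * j.+1)))
      (vset (r ^ k.+1) v `|` vset (r ^ k.+1) w) (vset (r ^ k.+1) c) /\
    vval phi (r ^ k.+1) x c = r%:R ^+ s * (vval phi (r ^ k.+1) x v * vval phi (r ^ k.+1) x w).
Proof.
have r_gt0 : (0 < r)%N by apply: ltnW.
have root1 (B : comNzRingType) (z : B) : \sum_(i < r) z ^+ i = 0 -> z ^+ r = 1.
  by move=> H; apply/eqP; rewrite -subr_eq0 subrX1 H mulr0.
elim: j k => [|j IH] k kj.
  exists 0%N; split=> // F B phi x Hx v w.
  have [||c [Hc Ec]] := @naive_product F B phi (r ^ k.+1) x v w.
  - by rewrite expn_gt0 r_gt0.
  - by rewrite expnSr exprM root1.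
  exists c; split; last by rewrite Ec expr0 mul1r.
  apply: computes_mono Hc _ (@sub_avail _ _) (fun t H => or_introl H).
  have : (r ^ k <= r)%N by by move: kj; clear -r_gt1; case: k => [|[|]] // _; rewrite ?expn1 // expn0; lia.
  rewrite !expnS expn0; nia.
(* Rounding so that [a <= b] provides enough powers of [y] to split both moduli completely, and
   [b <= 2^j] still allows the induction hypothesis. *)
set a := k./2; set b := (k - a)%N.
have kab : k = (a + b)%N by rewrite /b /a; lia.
have ab : (a <= b)%N by rewrite /b /a; lia.
have bj : (b <= 2 ^ j)%N by move: kj; rewrite expnS /b /a; lia.
have [s [sj IHb]] := IH b bj.
(* [s] comes from the products of vectors, [a] from the levels of the transform, and 1 from
   combining the two residues. *)
exists (s + a).+1; split.
  by move: sj; rewrite !expnS; lia.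
move=> F B phi x Hx v w.
set m := (r ^ a)%N; set y := x ^+ m.
have m_gt0 : (0 < m)%N by rewrite expn_gt0 r_gt0.
set z := y ^+ (r ^ b).
have zE : x ^+ (r ^ k) = z by rewrite /z /y -exprM -expnD -kab.
have z0 : \sum_(i < r) z ^+ i = 0 by rewrite -zE.
set N := (r ^ b.+1)%N.
have N_gt0 : (0 < N)%N by rewrite expn_gt0 r_gt0.
have Nk : (r ^ k.+1 = N * m)%N by rewrite /N /m -expnD; congr (_ ^ _)%N; lia.
have yN : y ^+ N = 1 by rewrite /N expnSr exprM root1.
pose blocks (f : nat -> F) u i := f (u + m * i)%N.
have blocksE (f : nat -> F) : vval phi (r ^ k.+1) x f = (vpoly phi N y m (blocks f)).[x].
  rewrite /vval Nk (sum_blocks N m (fun i => phi (f i) * x ^+ i)) exchange_big /=.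
  rewrite horner_sum; apply: eq_bigr => u _; rewrite hornerM hornerXn hornerC mulr_suml.
  by apply: eq_bigr => i _; rewrite exprD exprM mulrA mulrAC.
have blocks_sub (f : nat -> F) : mset m N (blocks f) `<=` vset (r ^ k.+1) f.
  move=> t [u um [i /= iN <-]]; apply: vsetP; rewrite Nk.
  by apply: leq_trans (_ : m * i.+1 <= _)%N; [move: um => /=; lia|rewrite mulnC leq_mul2r iN orbT].
have FP e := @fast_product F B phi r b y r_gt1 (root1 _ _ z0) (root_sums z0) _ _ (IHb F B phi y z0) a e
  (blocks v) (blocks w) (leqW ab).
(* The choices [e = 0] and [e = r^(b-a)] give the moduli [X^m - 1] and [X^m - z]. *)
have [C0 [HC0 [Q0]]] := FP 0%N; have [C1 [HC1 [Q1]]] := FP (r ^ (b - a))%N.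
rewrite muln0 expr0 -expnD subnKC // -/m -/N -/z => EC1 EC0.
set G := vpoly phi N y m (blocks v) * vpoly phi N y m (blocks w) in EC0 EC1.
set P0 := vpoly phi N y m C0 in EC0; set P1 := vpoly phi N y m C1 in EC1.
pose theta := \sum_(t < r) z ^+ t *+ t.
have thetaE : (1 - z) * theta = - r%:R.
  by rewrite /theta arith_geometric_sum z0 root1 // sub0r addrK.
have sP (A : nat -> nat -> F) : (size (vpoly phi N y m A) <= m)%N by apply: size_vpoly.
(* Modulo [(X^m - 1) (X^m - z)], the combination of [P1] and [P0] is [(z - 1) r^(s+a) G], and
   [theta] turns [z - 1] into [r]. Both sides have degree less than [2 m], so the congruence is an
   equality. *)
have GE : theta%:P * (('X^m - 1) * P1 - ('X^m - z%:P) * P0) = r%:R ^+ (s + a).+1 * G.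
  set M : {poly B} := ('X^m - 1) * ('X^m - z%:P).
  have Mmon : M \is monic.
    by rewrite monicMl -?[X in 'X^m - X]/(1%:P) monicXnsubC.
  have sM : size M = (m + m).+1.
    by rewrite size_Mmonic -?[X in 'X^m - X]/(1%:P) ?monicXnsubC ?monic_neq0 // ?size_XnsubC
       ?addnS ?monicXnsubC.
  have sX (c : B) A : (size (('X^m - c%:P) * vpoly phi N y m A)%R <= m + m)%N.
    apply: leq_trans (size_polyMleq _ _) _; rewrite size_XnsubC //=.
    by rewrite leq_add2l.
  apply/eqP; rewrite -subr_eq0; apply/eqP.
  have QE : theta%:P * (('X^m - 1) * P1 - ('X^m - z%:P) * P0) - r%:R ^+ (s + a).+1 * G
      = (theta%:P * (Q1 - Q0)) * M.
    have -> : r%:R ^+ (s + a).+1 * G = - ((1 - z) * theta)%:P * (r%:R ^+ (s + a) * G).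
      by rewrite thetaE rmorphN rmorph_nat opprK exprS -mulrA.
    rewrite EC0 EC1 /M; rewrite [((1 - z) * theta)%:P]rmorphM rmorphB rmorph1 /=.
    ring.
  rewrite QE (@small_multiple_eq0 _ (theta%:P * (Q1 - Q0)) M) ?mul0r //.
  rewrite -QE sM ltnS.
  apply: leq_trans (size_polyD _ _) _; rewrite geq_max; apply/andP; split.
    rewrite mul_polyC; apply: leq_trans (size_scale_leq _ _) _.
    apply: leq_trans (size_polyD _ _) _; rewrite geq_max size_polyN.
    by apply/andP; split; [have := sX 1 C1; rewrite polyC1|exact: sX].
  rewrite size_polyN -natrX mulr_natl -scaler_nat; apply: leq_trans (size_scale_leq _ _) _.
  apply: leq_trans (size_polyMleq _ _) _.
  by apply: leq_trans (leq_pred _) (leq_add (sP _) (sP _)).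
(* Substituting [x] for [X] turns [X^m] into [y], so [D u] stands for
   [(y - 1) C1_u - (y - z) C0_u]. *)
pose D u i : F := (vrot N 1 (C1 u) i + vrot N (r ^ b) (C0 u) i) - (C1 u i + vrot N 1 (C0 u) i).
(* Multiplication by [theta] by additions only: [theta] is the sum of [z^l] over the pairs
   [i < l < r], encoded as [q = l r + i]. *)
pose g u q : nat -> F := if (q %% r < q %/ r)%N then D u else fun=> 0.
pose E u i : F := \sum_(q < r * r) vrot N (q %/ r * r ^ b) (g u q) i.
exists (fun q => E (q %% m)%N (q %/ m)%N); split.
  apply: (@computes_seq _ (2 * (m * (8 * r ^ 3 * (r ^ b * (2 ^ j * j.+1))) + 3 * a * r ^ a.+1 * N))
     (m * (N * 3) + m * (N * (r * r))) _ _ (mset m N C1 `|` mset m N C0)).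
  - rewrite mul2n -addnn.
    apply: computes_pair (leqnn _).
    + apply: computes_mono HC1 _ _ (fun t H => or_introl H) => // t.
      by move=> [] /blocks_sub H; left; [left|right].
    + apply: computes_mono HC0 _ _ (fun t H => or_introl H) => // t.
      by move=> [] /blocks_sub H; left; [left|right].
  - apply: (@computes_seq _ (m * (N * 3)) (m * (N * (r * r))) _ _ (mset m N D)) => //.
      apply: computes_bigcup => u um; apply: computes_vset => i iN.
      set U := _ `|` _.
      have HU0 t : vset N (C0 u) t -> avail U t by move=> H; left; right; right; exists u.
      have HU1 t : vset N (C1 u) t -> avail U t by move=> H; left; right; left; exists u.
      apply: (@computes_seq _ 2 1 _ _ ([set (vrot N 1 (C1 u) i + vrot N (r ^ b) (C0 u) i)] `|`
         [set (C1 u i + vrot N 1 (C0 u) i)])) => //.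
        apply: (@computes_pair _ 1 1) => //.
          apply: computes_op; last by left.
            by apply: HU1; apply: vrot_in.
          by apply: HU0; apply: vrot_in.
        apply: computes_op; last by left.
          by apply: HU1; apply: vsetP.
        by apply: HU0; apply: vrot_in.
      apply: computes_op; last by right; left.
        by left; right; left.
      by left; right; right.
    apply: (@computes_mono _ (m * (N * (r * r))) _ _ _ (mset m N E) _ _ _ (@sub_avail _ _)); last first.
    + move=> t [q /= qN <-]; left; apply: msetP; first by rewrite ltn_pmod.
      by rewrite ltn_divLR // -Nk.
    + by [].
    apply: computes_bigcup => u um.
    apply: (@computes_rotsum _ _ N_gt0 _ (r * r) (fun q => q %/ r * r ^ b)%N (g u)) => q qr.
    rewrite /g; case: ifP => _ t [i /= iN <-]; last by right; left.
    by left; right; apply: msetP.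
  (* The [2 m] recursive products take the share [j + 1] of the new factor [j + 2]; all the linear
     work fits in the remaining share. *)
  - rewrite /N kab !expnD !expnS -/m.
    have aj : (a <= 2 ^ j)%N by apply: leq_trans bj.
    have P2 : (0 < 2 ^ j)%N by rewrite expn_gt0.
    have H1 : (6 * a * (r * r) + 3 * r + r * r * r <= 8 * (r * (r * r)) * (2 * 2 ^ j))%N by nia.
    have : (m * r ^ b * (6 * a * (r * r) + 3 * r + r * r * r) <=
            m * r ^ b * (8 * (r * (r * r)) * (2 * 2 ^ j)))%N by rewrite leq_mul2l H1 orbT.
    rewrite expn0 !muln1; move: (2 ^ j)%N (r ^ b)%N => X Y; lia.
have xm : x ^+ m = y by [].
rewrite !blocksE.
have := congr1 (fun P => P.[x]) GE.
rewrite -natrX mulr_natl hornerMn !hornerM !hornerD !hornerN !hornerM !hornerD !hornerN hornerXn !hornerC xm -mulr_natl natrX => <-.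
have vE u : vval phi N y (E u) = theta * vval phi N y (D u).
  rewrite (vval_sum phi N y (r * r) (fun q => vrot N (q %/ r * r ^ b) (g u q))).
  under eq_bigr do rewrite vval_rot //.
  rewrite (sum_blocks r r (fun q => y ^+ (q %/ r * r ^ b) * vval phi N y (g u q))).
  rewrite /theta mulr_suml; apply: eq_bigr => l _.
  have step (i : 'I_r) : y ^+ ((i + r * l) %/ r * r ^ b) * vval phi N y (g u (i + r * l)%N)
      = if (i < l)%N then z ^+ l * vval phi N y (D u) else 0.
    have -> : (i + r * l = l * r + i)%N by lia.
    rewrite /g divnMDl // divn_small // addn0 modnMDl modn_small // mulnC exprM -/z.
    case: ifP => _ //; rewrite /vval big1 ?mulr0 // => t _.
    by rewrite rmorph0 mul0r.
  under eq_bigr do rewrite step.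
  by rewrite -big_mkcond /= (big_ord_narrow (ltnW (ltn_ord l))) sumr_const card_ord mulrnAl.
have vD u : vval phi N y (D u) = (y - 1) * vval phi N y (C1 u) - (y - z) * vval phi N y (C0 u).
  have -> : vval phi N y (D u) = (vval phi N y (vrot N 1 (C1 u)) + vval phi N y (vrot N (r ^ b) (C0 u)))
      - (vval phi N y (C1 u) + vval phi N y (vrot N 1 (C0 u))).
    by rewrite /vval -!big_split -sumrB; apply: eq_bigr => i _; rewrite !(rmorphB, rmorphD) /=; ring.
  rewrite !vval_rot // -/z; ring.
rewrite /P1 /P0 /vpoly !horner_sum !mulr_sumr -sumrB mulr_sumr.
apply: eq_bigr => u _; rewrite !hornerM !hornerC !hornerXn.
rewrite (_ : vval phi N y (blocks _ u) = vval phi N y (E u)); first by rewrite vE vD; ring.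
apply: eq_bigr => i _; rewrite /blocks.
have -> : (u + m * i = i * m + u)%N by lia.
by rewrite divnMDl // divn_small // addn0 modnMDl modn_small.
Qed.

End CyclotomicProduct.

(** * Polynomial multiplication over a commutative ring *)

Lemma root_sums2 (B : comNzRingType) (z : B) : \sum_(i < 2) z ^+ i = 0 ->
  forall l, (0 < l < 2)%N -> \sum_(j < 2) z ^+ (2.-1 * (j * l)) = 0.
Proof. by move=> H [|[|]] // _; under eq_bigr do rewrite mul1n muln1. Qed.

Lemma root_sums3 (B : comNzRingType) (z : B) : \sum_(i < 3) z ^+ i = 0 ->
  forall l, (0 < l < 3)%N -> \sum_(j < 3) z ^+ (3.-1 * (j * l)) = 0.
Proof.
move=> H; have z3 : z ^+ 3 = 1 by apply/eqP; rewrite -subr_eq0 subrX1 H mulr0.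
have H' : 1 + z + z ^+ 2 = 0 by rewrite -H !big_ord_recr big_ord0 /= add0r expr0 expr1.
move=> [|[|[|]]] // _; rewrite !big_ord_recr big_ord0 /= add0r.
  by rewrite -[RHS]H' (_ : (2 * (2 * 1) = 3 + 1)%N) // exprD z3 mul1r addrAC.
rewrite -[RHS]H' (_ : (2 * (1 * 2) = 3 + 1)%N) // (_ : (2 * (2 * 2) = 3 + 3 + 2)%N) //.
by rewrite !exprD z3 !mul1r.
Qed.

(** Binary expansion: double the half, then add the parity bit, which is a free constant. *)
Lemma computes_nat (F : comNzRingType) (U : set F) l m : (m < 2 ^ l)%N ->
  computes (2 * l) U [set m%:R].
Proof.
elim: l m => [|l IH] m.
  rewrite expn0 ltnS leqn0 => /eqP ->; apply: computes_done => z ->.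
  by right; left.
rewrite expnS => H; have /IH K : (m./2 < 2 ^ l)%N by lia.
apply: (computes_seq K (d := 2)); last by lia.
apply: (@computes_seq _ 1 1 _ _ [set m./2%:R + m./2%:R]) => //.
  by apply: computes_op; last (by left); left; right.
apply: (@computes_op _ _ (m./2%:R + m./2%:R) (odd m)%:R); first by left; right.
  by right; case: (odd m); [right|left].
by left; rewrite -!natrD; congr _%:R; lia.
Qed.

(** The infinite range spares a length bound: the entries beyond the size are 0, which is free. *)
Definition coefs (F : comNzRingType) (p : {poly F}) : set F := range (fun i => p`_i).

Lemma availC0 (F : comNzRingType) (U : set F) : avail U 0. Proof. by right; left. Qed.

Lemma computes_coefs (F : comNzRingType) n c (U : set F) (p : {poly F}) :
  (size p <= n)%N -> (forall i, (i < n)%N -> computes c U [set p`_i]) ->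
  computes (n * c) U (coefs p).
Proof.
move=> pn /computes_vset H; apply: computes_mono H _ (@sub_avail _ _) _ => //.
move=> z [i _ <-]; case: (ltnP i n) => H; first by left; apply: vsetP.
by rewrite nth_default ?(leq_trans pn) //; right; apply: availC0.
Qed.

Section ScaledProduct.
Variable r : nat.
Hypothesis r_gt1 : (1 < r)%N.
Hypothesis root_sums : forall (B : comNzRingType) (z : B), \sum_(i < r) z ^+ i = 0 ->
  forall l, (0 < l < r)%N -> \sum_(j < r) z ^+ (r.-1 * (j * l)) = 0.

(** With [n = r^k], the computation takes place modulo [h = 1 + X^n + ... + X^(n(r-1))], where the
    class of [X] satisfies the equation asked of [x]. The product has degree less than [n <= deg h],
    so it equals its remainder. *)
Lemma scaled_product j k : (k <= 2 ^ j)%N ->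
  exists s, (s <= 2 ^ j.+1)%N /\
  forall (F : comNzRingType) (p q : {poly F}),
  (size p <= r ^ k)%N -> (size q <= r ^ k)%N -> (size (p * q)%R <= r ^ k)%N ->
  computes (8 * r ^ 3 * (r ^ k * (2 ^ j * j.+1)) + r ^ k.+1) (coefs p `|` coefs q)
    (coefs (r%:R ^+ s * (p * q))).
Proof.
move=> kj.
have [s [sj Hs]] := cyclotomic_product r_gt1 root_sums kj.
exists s; split=> // F p q sp sq spq.
set n := (r ^ k)%N; set N := (r ^ k.+1)%N.
have NE : N = (r * n)%N by rewrite /N expnS.
have n_gt0 : (0 < n)%N by rewrite expn_gt0 ltnW.
pose h : {poly F} := \sum_(i < r) 'X^(n * i).
have r_gt0 : (0 < r)%N by apply: ltnW.
have [h1 sh1 hE] : exists2 h1 : {poly F}, (size h1 <= n * r.-1)%N & h = 'X^(n * r.-1) + h1.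
  exists (\sum_(i < r.-1) 'X^(n * i)); last first.
    by rewrite /h; move: (n); case: (r) r_gt0 => // r' _ n'; rewrite big_ord_recr addrC.
  apply: (leq_trans (size_sum _ _ _)); apply/bigmax_leqP => u _.
  rewrite size_polyXn; apply: leq_trans (_ : n * u.+1 <= _)%N; first by lia.
  by rewrite leq_mul2l ltn_ord orbT.
have sh : size h = (n * r.-1).+1 by rewrite hE size_polyDl size_polyXn // ltnS.
have hmon : h \is monic by rewrite monicE hE lead_coefDl ?lead_coefXn // size_polyXn ltnS.
(* The quotient ring is taken modulo [mk_monic h], which is [h] itself when [h] is monic and not
   constant. *)
have mh : mk_monic h = h.
  by rewrite /mk_monic sh hmon ltnS muln_gt0 n_gt0 -ltnS prednK ?r_gt1 // ltnW.
pose x : {poly %/ h} := in_qpoly h 'X.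
have vE (f : nat -> F) : vval (qpolyC h) N x f = in_qpoly h (\poly_(i < N) f i).
  rewrite poly_def rmorph_sum; apply: eq_bigr => i _ /=.
  rewrite -mul_polyC !rmorphM !rmorphXn /=; congr (_ * _).
  apply/val_inj; rewrite /= Pdiv.CommonRing.rmodp_small // mh sh ltnS (leq_trans (size_polyC_leq1 _)) //.
  by rewrite muln_gt0 n_gt0; lia.
have [|c [Hc Ec]] := Hs F {poly %/ h} (qpolyC h) x _ (nth 0 p) (nth 0 q).
  transitivity (in_qpoly h h).
    by rewrite {2}/h rmorph_sum; apply: eq_bigr => i _; rewrite -exprM rmorphXn.
  by apply/val_inj; rewrite /= mh Pdiv.RingMonic.rmodpp.
have np (f : {poly F}) : (size f <= n)%N -> \poly_(i < N) f`_i = f.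
  move=> sf; apply/polyP => i; rewrite coef_poly; case: ltnP => // H.
  by rewrite nth_default // (leq_trans sf) // (leq_trans _ H) // NE leq_pmull // ltnW.
(* The vector [c] has one block of length [n] more than a remainder modulo [h]. Subtracting [h]
   times the last block clears that block, at one subtraction per entry. *)
pose d i := c i - c (i %% n + n * r.-1)%N.
have dE : \poly_(i < N) d i = r%:R ^+ s * (p * q).
  have EQ : in_qpoly h (\poly_(i < N) d i) = in_qpoly h (r%:R ^+ s * (p * q)).
    rewrite !rmorphM rmorphXn rmorph_nat /= -(np p sp) -(np q sq) -!vE -Ec vE.
    pose Q := \poly_(i < n) c (i + n * r.-1)%N.
    rewrite (_ : \poly_(i < N) d i = \poly_(i < N) c i - Q * h).
      rewrite rmorphB rmorphM /= (_ : in_qpoly h h = 0) ?mulr0 ?subr0 //.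
      by apply/val_inj; rewrite /= mh Pdiv.RingMonic.rmodpp.
    rewrite !poly_def NE /h mulr_sumr.
    transitivity (\sum_(i < r * n) c i *: 'X^i - \sum_(i < r * n) c (i %% n + n * r.-1)%N *: 'X^i : {poly F}).
      by rewrite -sumrB; apply: eq_bigr => i _; rewrite -scalerBl.
    congr (_ - _); rewrite (sum_blocks r n (fun i => c (i %% n + n * r.-1)%N *: 'X^i)).
    apply: eq_bigr => l _; rewrite /Q poly_def mulr_suml; apply: eq_bigr => u _.
    have -> : (u + n * l = l * n + u)%N by lia.
    by rewrite modnMDl modn_small // -scalerAl -exprD; congr (_ *: 'X^_); lia.
  have := congr1 (fun t : {poly %/ h} => val t) EQ.
  rewrite /= !Pdiv.CommonRing.rmodp_small //.
    rewrite mh sh ltnS -natrX mulr_natl -scaler_nat (leq_trans (size_scale_leq _ _)) //.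
    by apply: leq_trans spq _; rewrite leq_pmulr //; lia.
  rewrite mh sh ltnS; apply/leq_sizeP => i Hi; rewrite coef_poly; case: ltnP => // iN.
  rewrite /d (_ : (i %% n + n * r.-1 = i)%N) ?subrr //.
  have iE : i = (r.-1 * n + (i - n * r.-1))%N by lia.
  rewrite {1}iE modnMDl modn_small; first by lia.
  by move: iN; rewrite NE -{1}(prednK r_gt0); lia.
apply: (@computes_seq _ (8 * r ^ 3 * (r ^ k * (2 ^ j * j.+1))) N _ _ (vset N c)) => //.
  apply: computes_mono Hc _ _ (fun t H => or_introl H) => //.
  by move=> t [] [i _ <-]; left; [left|right]; exists i.
rewrite -dE -[X in computes X]muln1; apply: computes_coefs; first exact: size_poly.
move=> i iN; rewrite coef_poly iN.
apply: (@computes_op _ _ (c i) (c (i %% n + n * r.-1)%N)); last by right; left.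
  by left; right; apply: vsetP.
left; right; apply: vsetP.
have := ltn_pmod i n_gt0; rewrite NE -{2}(prednK r_gt0); lia.
Qed.

End ScaledProduct.

(** Radix 3 thus handles the same inputs as radix 2 at the price of a constant factor. *)
Lemma exp3_between_exp2 K : exists k, [/\ (k <= K)%N, (2 ^ K <= 3 ^ k)%N & (3 ^ k <= 3 * 2 ^ K)%N].
Proof.
elim: K => [|K [k [kK H1 H2]]]; first by exists 0%N.
case: (leqP (2 ^ K.+1) (3 ^ k)) => H; last by exists k.+1; split=> //; rewrite !expnS in H *; lia.
by exists k; split=> //; [apply: leqW|rewrite expnS; lia].
Qed.

(* Radix 2 yields [2^s p q] and radix 3 yields [3^s' p q]; an integer Bezout
   relation recovers [p q] without any division. *)
Lemma fast_poly_mul (F : comNzRingType) K j (p q : {poly F}) : (K <= 2 ^ j)%N ->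
  (size p <= 2 ^ K)%N -> (size q <= 2 ^ K)%N -> (size (p * q)%R <= 2 ^ K)%N ->
  computes (1000 * (2 ^ K * (2 ^ j * j.+1))) (coefs p `|` coefs q) (coefs (p * q)).
Proof.
move=> Kj sp sq spq; have [k [kK H1 H2]] := exp3_between_exp2 K.
have [s [sj Hs]] := scaled_product (r := 2) isT root_sums2 Kj.
have [s' [s'j Hs']] := scaled_product (r := 3) isT root_sums3 (leq_trans kK Kj).
have {}Hs := Hs F p q sp sq spq.
have {}Hs' := Hs' F p q (leq_trans sp H1) (leq_trans sq H1) (leq_trans spq H1).
have cop : coprime (3 ^ s') (2 ^ s) by rewrite coprimeXl // coprimeXr.
have p3 : (0 < 3 ^ s')%N by rewrite expn_gt0.
(* [v 3^s' = 1 + a 2^s] with [a < 3^s' <= 2^(2 s')] and [v <= 2^s]: both numbers are built in a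
   number of operations linear in [s + s']. *)
have [a a3 /dvdnP[v]] := Bezoutl (2 ^ s) p3.
rewrite (eqP cop) => E.
have v2 : (v <= 2 ^ s)%N.
  rewrite -(leq_pmul2r p3) -E [(2 ^ s * _)%N]mulnC.
  apply: leq_trans (_ : a.+1 * 2 ^ s <= _)%N; last by rewrite leq_mul2r a3 orbT.
  by rewrite mulSn leq_add2r expn_gt0.
have eq1 : (v%:R * (3%:R ^+ s' * (p * q)) - a%:R * (2%:R ^+ s * (p * q)) = p * q :> {poly F}).
  rewrite !mulrA -!natrX -!natrM -E natrD; ring.
apply: (@computes_seq _ (8 * 2 ^ 3 * (2 ^ K * (2 ^ j * j.+1)) + 2 ^ K.+1 +
    (8 * 3 ^ 3 * (3 ^ k * (2 ^ j * j.+1)) + 3 ^ k.+1) + (2 * s.+1 + 2 * (2 * s'))) (2 ^ K * 3) _ _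
    ((coefs (2%:R ^+ s * (p * q)) `|` coefs (3%:R ^+ s' * (p * q))) `|` ([set v%:R] `|` [set a%:R]))).
- apply: computes_pair (leqnn _); first by apply: computes_pair (leqnn _).
  apply: computes_pair (leqnn _).
    by apply: computes_nat; rewrite expnS (leq_ltn_trans v2) // ltn_Pmull // expn_gt0.
  apply: computes_nat; apply: (leq_trans a3); rewrite expnM.
  by case: (s') => // t; rewrite leq_exp2r.
- apply: computes_coefs => // i _; set U := _ `|` _.
  have E2 : p * q = (v%:R *: (3%:R ^+ s' * (p * q)) - a%:R *: (2%:R ^+ s * (p * q))).
    by rewrite !scaler_nat -!(mulr_natl (_ * (p * q))).
  rewrite E2 coefB !coefZ.
  apply: (@computes_seq _ 2 1 _ _ ([set v%:R * (3%:R ^+ s' * (p * q))`_i] `|`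
     [set a%:R * (2%:R ^+ s * (p * q))`_i])) => //.
    apply: (@computes_pair _ 1 1) => //.
      apply: computes_op; last by right; right.
        by left; right; right; left.
      by left; right; left; right; exists i.
    apply: computes_op; last by right; right.
      by left; right; right; right.
    by left; right; left; left; exists i.
  apply: computes_op; last by right; left.
    by left; right; left.
  by left; right; right.
- have P2 : (0 < 2 ^ K)%N by rewrite expn_gt0.
  have PJ : (2 ^ j <= 2 ^ j * j.+1)%N by rewrite leq_pmulr.
  have PJ0 : (0 < 2 ^ j)%N by rewrite expn_gt0.
  move: sj s'j H2 P2 PJ PJ0; rewrite !expnS.
  move: (2 ^ K)%N (2 ^ j)%N (2 ^ j * j.+1)%N (3 ^ k)%N => X Y J Z.
  move=> sj s'j H2 P2 PJ PJ0.
  have G1 : (Z * J <= 3 * X * J)%N by rewrite leq_mul2r H2 orbT.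
  have G2 : (X <= X * J)%N by rewrite leq_pmulr // (leq_trans PJ0).
  have G3 : (J <= X * J)%N by rewrite leq_pmull.
  lia.
Qed.

(** * Multipoint evaluation *)

Section ModXn.
Variable F : comNzRingType.
Implicit Types p q : {poly F}.

Lemma congXnP n p q : cong 'X^n p q <-> forall i, (i < n)%N -> p`_i = q`_i.
Proof.
split=> [[Q ->] i iN|H]; first by rewrite coefD coefMXn iN addr0.
exists (drop_poly n (p - q)).
rewrite -[X in X = _](subrK q) addrC -{1}(poly_take_drop n (p - q)).
rewrite (_ : take_poly n (p - q) = 0) ?add0r //.
apply/polyP => i; rewrite coef_take_poly coef0 coefB; case: ltnP => // /H ->.
by rewrite subrr.
Qed.

Lemma cong_take n p : cong 'X^n (take_poly n p) p.
Proof. by apply/congXnP => i iN; rewrite coef_take_poly iN. Qed.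

Lemma coefM1subCX p (c : F) i :
  (p * (1 - c *: 'X))`_i = p`_i - c * (if i is i'.+1 then p`_i' else 0).
Proof.
rewrite mulrBr mulr1 coefB -scalerAr coefZ coefMX; case: i => [|i] //=.
Qed.

End ModXn.

Section Multipoint.
Variables (F : comNzRingType) (x : nat -> F).
Implicit Types (f g h u : {poly F}) (U : set F).

(** The reversal of the usual subproduct: its constant coefficient is 1, so it is invertible modulo
    [X^n] over any ring. *)
Definition node a m : {poly F} := \prod_(i < m) (1 - x (a + i) *: 'X).

Lemma nodeS a m : node a m.+1 = node a m * (1 - x (a + m) *: 'X).
Proof. by rewrite /node big_ord_recr. Qed.

Lemma nodeD a m m' : node a (m + m') = node a m * node (a + m) m'.
Proof.
rewrite /node big_split_ord /=; congr (_ * _); apply: eq_bigr => i _.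
by rewrite addnA.
Qed.

Lemma size_node a m : (size (node a m) <= m.+1)%N.
Proof.
elim: m => [|m IH]; first by rewrite /node big_ord0 size_poly1.
apply/leq_sizeP => i im; rewrite nodeS coefM1subCX.
case: i im => // i im; rewrite !nth_default ?mulr0 ?subr0 //.
  exact: leq_trans IH im.
exact: leq_trans IH (ltnW im).
Qed.

Lemma computes_node a m M U : (m <= M)%N -> (forall i, (i < m)%N -> U (x (a + i))) ->
  computes (m * (M.+1 * 2)) U (coefs (node a m)).
Proof.
elim: m => [|m IH] mM Ux.
  apply: computes_done => z [i _ <-]; rewrite /node big_ord0 coef1.
  by case: (i == 0%N); right; [right|left].
apply: (computes_seq (IH _ _) (d := M.+1 * 2)); last by rewrite mulSn addnC.
- exact: ltnW.
- by move=> i im; apply: Ux; apply: leqW.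
apply: computes_coefs => [|i iM]; first exact: leq_trans (size_node _ _) _.
rewrite nodeS coefM1subCX; set c := x _; set d := (if i is _.+1 then _ else _).
have Ud : avail (U `|` coefs (node a m)) d.
  by rewrite /d; case: i {iM d} => [|i]; [right; left|left; right; exists i].
apply: (@computes_seq _ 1 1 _ _ [set c * d]) => //.
  apply: computes_op Ud _; last by right; right.
  by left; left; apply: Ux.
apply: computes_op; last by right; left.
  by left; left; right; exists i.
by left; right.
Qed.

(** The factors are divided out one by one: division by [1 - c X] is the recurrence
    [h_i = H_i + c h_(i-1)], two operations per coefficient. *)
Lemma computes_node_inverse n a m U : (0 < n)%N -> (forall i, (i < m)%N -> U (x (a + i))) ->
  exists H : {poly F}, [/\ (size H <= n)%N, computes (m * (n * 2)) U (coefs H) &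
    cong 'X^n (node a m * H) 1].
Proof.
move=> n_gt0; elim: m => [|m IH] Ux.
  exists 1; rewrite size_poly1; split=> //.
    apply: computes_done => z [i _ <-]; rewrite coef1.
    by case: (i == 0%N); right; [right|left].
  by rewrite /node big_ord0 mulr1; apply: cong_refl.
have [|H [sH cH EH]] := IH; first by move=> i im; apply: Ux; apply: leqW.
set c := x (a + m).
pose h := fix h i := if i is i'.+1 then H`_i + c * h i' else H`_0.
exists (\poly_(i < n) h i); split; first exact: size_poly.
- apply: (computes_seq cH (d := n * 2)); last by rewrite mulSn addnC.
  have K : computes (n * 2) (U `|` coefs H) (\bigcup_(i in `I_n) [set h i]).
    apply: computes_iter => -[|i] im.
      by apply: computes_done => z ->; left; left; right; exists 0%N.
    apply: (@computes_seq _ 1 1 _ _ [set c * h i]) => //.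
      apply: computes_op; last by right; right.
        by left; left; left; apply: Ux.
      by left; right; exists i => //=; apply: ltnW.
    apply: (@computes_op _ _ H`_i.+1 (c * h i)); last by left.
      by left; left; left; right; exists i.+1.
    by left; right.
  apply: computes_mono K _ (@sub_avail _ _) _ => // z [i _ <-]; rewrite coef_poly.
  by case: ltnP => im; [left; exists i|right; apply: availC0].
rewrite nodeS -mulrA [(1 - _) * _]mulrC.
apply: cong_trans (congM (cong_refl _ _) _) EH; apply/congXnP => i im.
rewrite coefM1subCX coef_poly im; case: i im => [|i] im /=; first by rewrite mulr0 subr0.
by rewrite coef_poly (ltnW im) addrK.
Qed.


Definition revpoly n (f : {poly F}) : {poly F} := \poly_(i < n) f`_(n.-1 - i).

(* [u] holds the [2^l] leading coefficients modulo [X^n] of the power series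
   [revpoly n f / node (t * 2^l) (2^l)].  The children of a node are obtained by
   multiplying by the polynomial of the sibling; at a leaf, the only coefficient
   left is [\sum_i f_i x_t^i]. *)
Definition tree_state n f l t (u : {poly F}) := exists h : {poly F},
  [/\ (size h <= n)%N, cong 'X^n (node (t * 2 ^ l) (2 ^ l) * h) (revpoly n f)
    & u = drop_poly (n - 2 ^ l) h].

(** Dividing the reversal of [f] by [1 - x_t X] is Horner's rule: the successive coefficients are
    its partial results, the one of index [n - 1] being the value. *)
Lemma tree_state_leaf n f t u : (0 < n)%N -> (size f <= n)%N ->
  tree_state n f 0 t u -> u`_0 = f.[x t].
Proof.
move=> n_gt0 sf [h [sh /congXnP Eh ->]]; rewrite coef_drop_poly add0n expn0 subn1.
have {}Eh i : (i < n)%N -> h`_i = f`_(n.-1 - i) + x t * (if i is i'.+1 then h`_i' else 0).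
  move=> im; have := Eh i im; rewrite coef_poly im => <-.
  by rewrite /node expn0 big_ord1 mulrC muln1 addn0 coefM1subCX subrK.
have {Eh} K i : (i < n)%N -> h`_i = \sum_(j < i.+1) f`_(n.-1 - i + j) * x t ^+ j.
  elim: i => [|i IH] im; rewrite Eh //.
    by rewrite big_ord1 mulr0 addn0 expr0 mulr1 addr0.
  rewrite IH; last exact: ltnW.
  rewrite [RHS]big_ord_recl addn0 expr0 mulr1; congr (_ + _).
  rewrite mulr_sumr; apply: eq_bigr => j _; rewrite lift0 exprS mulrCA.
  by congr (f`_ _ * _); lia.
rewrite K ?prednK // (horner_coef_wide _ sf).
by apply: eq_bigr => j _; rewrite subnn add0n.
Qed.

(** The part of [h] below degree [n - 2 s], multiplied by [P2] of degree at most [s], stays below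
    degree [n - s]; so the top [s] coefficients of [P2 * h] modulo [X^n] depend only on the top
    [2 s] of [h]. *)
Lemma tree_child_step n (P1 P2 g h : {poly F}) s : (s + s <= n)%N -> (size P2 <= s.+1)%N ->
  (size h <= n)%N -> cong 'X^n (P1 * P2 * h) g ->
  exists h', [/\ (size h' <= n)%N, cong 'X^n (P1 * h') g &
    drop_poly (n - s) h' = take_poly s (drop_poly s (P2 * drop_poly (n - (s + s)) h))].
Proof.
move=> sn sP2 sh Eh; exists (take_poly n (P2 * h)); split.
- exact: size_take_poly.
- apply: cong_trans Eh; rewrite -mulrA.
  exact: congM (cong_refl _ _) (cong_take _ _).
apply/polyP => i; rewrite coef_drop_poly !coef_take_poly coef_drop_poly.
rewrite (_ : (i + (n - s) < n)%N = (i < s)%N); last by lia.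
case: ifP => // im; rewrite -{1}(poly_take_drop (n - (s + s)) h) mulrDr coefD mulrA coefMXn.
rewrite [X in X + _]nth_default; last first.
  apply: leq_trans (size_polyMleq _ _) _.
  by have := size_take_poly (n - (s + s)) h; move: sP2; lia.
by rewrite add0r ifF; [congr (_`_ _)|]; lia.
Qed.

Lemma tree_state_child n f l t b j (u : {poly F}) U :
  (2 ^ l.+1 <= n)%N -> (l.+2 <= 2 ^ j)%N -> (b < 2)%N ->
  coefs (node ((t * 2 + (1 - b)) * 2 ^ l) (2 ^ l)) `<=` U ->
  tree_state n f l.+1 t u ->
  exists u', computes (1000 * (2 ^ l.+2 * (2 ^ j * j.+1))) (U `|` coefs u) (coefs u') /\
    tree_state n f l (t * 2 + b) u'.
Proof.
move=> ln lj b2 PU [h [sh Eh uE]]; set s := (2 ^ l)%N in PU *.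
have sn : (s + s <= n)%N by move: ln; rewrite expnS mul2n -addnn.
set P2 := node _ _ in PU; have sP2 : (size P2 <= s.+1)%N by apply: size_node.
have Eh' : cong 'X^n (node ((t * 2 + b) * s) s * P2 * h) (revpoly n f).
  move: Eh; rewrite expnS -/s mul2n -addnn nodeD.
  rewrite (_ : t * (s + s) + s = (t * 2 + 1) * s)%N; last by lia.
  rewrite (_ : t * (s + s) = (t * 2 + 0) * s)%N; last by lia.
  rewrite /P2; case: b b2 {PU P2 sP2} => [|[|]] // _.
  by rewrite [node _ _ * node _ _]mulrC.
have [h' [sh' Eh2 Dh]] := tree_child_step sn sP2 sh Eh'.
exists (take_poly s (drop_poly s (P2 * u))); split; last first.
  by exists h'; split; rewrite // Dh uE expnS mul2n -addnn.
have su : (size u <= s + s)%N.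
  by rewrite uE size_drop_poly expnS mul2n -addnn -/s; lia.
have s4 : (2 ^ l.+2 = s + s + (s + s))%N by rewrite !expnS -/s; lia.
have s_gt0 : (0 < s)%N by rewrite expn_gt0.
(* The product has at most [3 s] coefficients, so length [4 s = 2^(l+2)] suffices. *)
have K : computes (1000 * (2 ^ l.+2 * (2 ^ j * j.+1))) (coefs P2 `|` coefs u) (coefs (P2 * u)).
  apply: fast_poly_mul => //; rewrite s4; [lia|lia|].
  by apply: leq_trans (size_polyMleq _ _) _; lia.
apply: computes_mono K _ _ _ => //.
  by move=> z [/PU H|H]; left; [left|right].
move=> z [i _ <-]; rewrite coef_take_poly coef_drop_poly; case: ifP => _.
  by left; exists (i + s)%N.
by right; apply: availC0.
Qed.

(** Each level down doubles the number of products and halves their length, so all levels get the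
    same budget; the extra one in [d.+1] pays for the root. *)
Lemma tree_states kap j f U : (kap.+1 <= 2 ^ j)%N -> (size f <= 2 ^ kap)%N ->
  (forall l t, (l < kap)%N -> (t < 2 ^ (kap - l))%N ->
     coefs (node (t * 2 ^ l) (2 ^ l)) `<=` U) ->
  (exists2 H : {poly F}, (size H <= 2 ^ kap)%N /\ cong 'X^(2 ^ kap) (node 0 (2 ^ kap) * H) 1 &
     coefs H `<=` U) ->
  coefs f `<=` U ->
  forall d, (d <= kap)%N ->
  exists u : nat -> {poly F},
    computes (d.+1 * (4000 * (2 ^ kap * (2 ^ j * j.+1)))) U (\bigcup_(t in `I_(2 ^ d)) coefs (u t)) /\
    forall t, (t < 2 ^ d)%N -> tree_state (2 ^ kap) f (kap - d) t (u t).
Proof.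
move=> kj sf PU [H [sH EH] HU] fU; elim=> [_|d IH dk].
  set n := (2 ^ kap)%N in PU sf sH EH *.
  have sr : (size (revpoly n f) <= n)%N by apply: size_poly.
  have n_gt0 : (0 < n)%N by rewrite expn_gt0.
  exists (fun=> take_poly n (H * revpoly n f)); split.
    have K : computes (1000 * (2 ^ kap.+1 * (2 ^ j * j.+1)))
        (coefs H `|` coefs (revpoly n f)) (coefs (H * revpoly n f)).
      apply: fast_poly_mul => //; rewrite expnS -/n; [lia|lia|].
      by apply: leq_trans (size_polyMleq _ _) _; lia.
    apply: computes_mono K _ _ _.
    - by rewrite expnS -/n; lia.
    - move=> z [/HU|[i _ <-]]; first by left.
      rewrite coef_poly; case: ifP => _; last by apply: availC0.
      by left; apply: fU; exists (n.-1 - i)%N.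
    - move=> z [t _ [i _ <-]]; rewrite coef_take_poly; case: ifP => _.
        by left; exists i.
      by right; apply: availC0.
  move=> t; rewrite expn0 ltnS leqn0 => /eqP ->; rewrite subn0 /tree_state -/n.
  exists (take_poly n (H * revpoly n f)); split.
  - exact: size_take_poly.
  - rewrite mul0n; apply: cong_trans (congM (cong_refl _ _) (cong_take _ _)) _.
    rewrite mulrA -[X in cong _ _ X]mul1r; exact: congM EH (cong_refl _ _).
  - by rewrite subnn drop_poly0l.
have [u [Hu Su]] := IH (ltnW dk).
have lE : (kap - d = (kap - d.+1).+1)%N by lia.
set l := (kap - d.+1)%N in lE *.
have [|u' [Hu' Su']] := @computes_choice F (2 ^ d.+1) (1000 * (2 ^ l.+2 * (2 ^ j * j.+1)))
   (U `|` \bigcup_(t in `I_(2 ^ d)) coefs (u t)) _ (@coefs F) (tree_state (2 ^ kap) f l) 0.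
  move=> t; rewrite expnS => tm; set q := (t %/ 2)%N; set b := (t %% 2)%N.
  have b2 : (b < 2)%N by rewrite ltn_pmod.
  have qd : (q < 2 ^ d)%N by rewrite ltn_divLR // mulnC.
  have tE : t = (q * 2 + b)%N by rewrite -divn_eq.
  have := Su q qd; rewrite lE => /(@tree_state_child _ _ _ _ b j _ U) [].
  - by rewrite leq_exp2l // /l; lia.
  - by apply: leq_trans kj; rewrite /l; lia.
  - exact: b2.
  - apply: PU; first by rewrite /l; lia.
    rewrite (_ : kap - l = d.+1)%N; last by rewrite /l; lia.
    by rewrite expnS; lia.
  move=> v [Hv Sv]; exists v; split; last by rewrite tE.
  apply: computes_mono Hv _ _ (fun z H => or_introl H) => //.
  by move=> z [H1|H1]; left; [left|right; exists q].
exists u'; split=> //.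
apply: (computes_seq Hu Hu').
have -> : (2 ^ kap = 2 ^ d * 2 ^ l * 2)%N.
  by rewrite -expnD -expnSr; congr (_ ^ _)%N; rewrite /l; lia.
rewrite !expnS; move: (2 ^ d)%N (2 ^ l)%N (2 ^ j)%N => X Y Z; lia.
Qed.

Lemma multipoint_eval kap j f U : (kap.+1 <= 2 ^ j)%N -> (size f <= 2 ^ kap)%N ->
  (forall l t, (l < kap)%N -> (t < 2 ^ (kap - l))%N ->
     coefs (node (t * 2 ^ l) (2 ^ l)) `<=` U) ->
  (exists2 H : {poly F}, (size H <= 2 ^ kap)%N /\ cong 'X^(2 ^ kap) (node 0 (2 ^ kap) * H) 1 &
     coefs H `<=` U) ->
  coefs f `<=` U ->
  computes (kap.+1 * (4000 * (2 ^ kap * (2 ^ j * j.+1)))) U (vset (2 ^ kap) (fun t => f.[x t])).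
Proof.
move=> kj sf PU HU fU; have [u [Hu Su]] := tree_states kj sf PU HU fU (leqnn kap).
apply: computes_mono Hu _ (@sub_avail _ _) _ => // z [t /= tk <-].
left; exists t => //; exists 0%N => //.
by have := Su t tk; rewrite subnn => /tree_state_leaf -> //; rewrite expn_gt0.
Qed.

End Multipoint.

(** * Bivariate evaluation and straight-line programs *)

Section BivariateEvaluation.
Variable F : comNzRingType.
Implicit Types (U : set F).

Lemma computes_horner m U (v : nat -> F) (y : F) :
  (forall i, (i < m)%N -> avail U (v i)) -> avail U y ->
  computes (m * 2) U [set \sum_(i < m) v i * y ^+ i].
Proof.
move=> + Uy; elim: m v => [|m IH] v Uv.
  by apply: computes_done => z ->; rewrite big_ord0; apply: availC0.
have {}IH := IH (fun i => v i.+1) (fun i im => Uv i.+1 im).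
set w := \sum_(i < m) _ in IH.
apply: (computes_seq IH (d := 2)); last by rewrite mulSn addnC.
apply: (@computes_seq _ 1 1 _ _ [set y * w]) => //.
  apply: computes_op; last by right; right.
    by apply: availS Uy => z; left.
  by left; right.
apply: (@computes_op _ _ (v 0%N) (y * w)).
- by apply: availS (Uv 0%N isT) => z; left; left.
- by left; right.
left; rewrite big_ord_recl expr0 mulr1; congr (_ + _).
by rewrite mulr_sumr; apply: eq_bigr => i _; rewrite lift0 exprS mulrCA.
Qed.

Lemma computes_eval_block kap j m (x : nat -> F) (f : nat -> {poly F}) U :
  (kap.+1 <= 2 ^ j)%N -> (m <= 2 ^ kap)%N ->
  (forall i, (i < 2 ^ kap)%N -> U (x i)) ->
  (forall d, (d < m)%N -> (size (f d) <= 2 ^ kap)%N /\ coefs (f d) `<=` U) ->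
  computes (kap.+1 * (4010 * (2 ^ kap * 2 ^ kap * (2 ^ j * j.+1)))) U
    (mset m (2 ^ kap) (fun d t => (f d).[x t])).
Proof.
move=> kj mn Ux Uf; set n := (2 ^ kap)%N in mn Ux Uf *; set J := (2 ^ j * j.+1)%N.
have n_gt0 : (0 < n)%N by rewrite expn_gt0.
have J_gt0 : (0 < J)%N by rewrite muln_gt0 expn_gt0.
pose V := \bigcup_(l in `I_kap) \bigcup_(t in `I_(2 ^ (kap - l))) coefs (node x (t * 2 ^ l) (2 ^ l)).
have cV : computes (kap * (4 * (n * n))) U V.
  apply: computes_bigcup => l lk.
  have nE : n = (2 ^ (kap - l) * 2 ^ l)%N by rewrite -expnD subnK // ltnW.
  have K : computes (2 ^ (kap - l) * (2 ^ l * ((2 ^ l).+1 * 2))) U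
      (\bigcup_(t in `I_(2 ^ (kap - l))) coefs (node x (t * 2 ^ l) (2 ^ l))).
    apply: computes_bigcup => t tl; apply: computes_node => // i il.
    apply: Ux; rewrite nE; apply: leq_trans (_ : t.+1 * 2 ^ l <= _)%N; last by rewrite leq_mul2r tl orbT.
    by rewrite mulSn addnC ltn_add2r.
  apply: computes_mono K _ (@sub_avail _ _) (fun z H => or_introl H).
  (* The nodes of one level have total degree [n], and each linear factor costs
     [2 (2^l + 1) <= 4 n]. *)
  rewrite mulnA -nE [(4 * _)%N]mulnCA leq_mul2l; apply/orP; right.
  have : (2 ^ l <= n)%N by rewrite leq_exp2l // ltnW.
  by lia.
have [//|i im|H [sH cH EH]] := @computes_node_inverse F x n 0 n U; first exact: Ux.
apply: (@computes_seq _ (kap * (4 * (n * n)) + n * (n * 2)) (m * (kap.+1 * (4000 * (n * J)))) _ _ (V `|` coefs H)).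
- exact: computes_pair (leqnn _).
- apply: computes_bigcup => d dm; have [sf cf] := Uf d dm.
  apply: multipoint_eval => //.
  + by move=> l t lk tl z Hz; right; left; exists l => //; exists t.
  + by exists H => // z Hz; right; right.
  + by move=> z /cf Hz; left.
- have G1 : (m * (kap.+1 * (4000 * (n * J))) <= n * (kap.+1 * (4000 * (n * J))))%N by rewrite leq_mul2r mn orbT.
  have G2 : (n * n <= n * n * J)%N by rewrite leq_pmulr.
  have G3 : (kap.+1 * (n * n) <= kap.+1 * (n * n * J))%N by rewrite leq_mul2l G2 orbT.
  lia.
Qed.

Lemma computes_bivariate_eval kap j m (x y : nat -> F) (f : nat -> {poly F}) U :
  (kap.+1 <= 2 ^ j)%N -> (m <= 2 ^ kap)%N ->
  (forall i, avail U (x i)) -> (forall i, (i < m * m)%N -> avail U (y i)) ->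
  (forall d, (d < m)%N -> (size (f d) <= 2 ^ kap)%N /\ coefs (f d) `<=` avail U) ->
  computes (4012 * (kap.+1 * (2 ^ kap * 2 ^ kap * 2 ^ kap * (2 ^ j * j.+1)))) U
    (vset (m * m) (fun k => \sum_(d < m) (f d).[x k] * y k ^+ d)).
Proof.
move=> kj mn Ux Uy Uf; set n := (2 ^ kap)%N in mn Uf *; set J := (2 ^ j * j.+1)%N.
have n_gt0 : (0 < n)%N by rewrite expn_gt0.
have J_gt0 : (0 < J)%N by rewrite muln_gt0 expn_gt0.
(* As [m <= n], [m] blocks of [n] points cover the [m * m] points. They may overrun, which is why
   [x] has to be available at every index. *)
pose V q := mset m n (fun d t => (f d).[x (q * n + t)%N]).
apply: (@computes_seq _ (m * (kap.+1 * (4010 * (n * n * J)))) (m * m * (m * 2)) _ _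
  (\bigcup_(q in `I_m) V q)).
- apply: computes_bigcup => q qm.
  have K := @computes_eval_block kap j m (fun t => x (q * n + t)%N) f (avail U) kj mn
    (fun t _ => Ux _) Uf.
  by apply: computes_mono K _ _ (fun z H => or_introl H).
- apply: computes_vset => k km.
  apply: (@computes_horner m _ (fun d => (f d).[x k]) (y k)) => [d dm|].
    left; right; exists (k %/ n)%N => /=.
      by rewrite ltn_divLR // (leq_trans km) // leq_mul2l mn orbT.
    exists d => //; exists (k %% n)%N; first by rewrite /= ltn_pmod.
    by rewrite -divn_eq.
  by apply: availS (Uy k km) => z; left.
- have G1 : (m * (kap.+1 * (4010 * (n * n * J))) <= n * (kap.+1 * (4010 * (n * n * J))))%N.
    by rewrite leq_mul2r mn orbT.
  have G2 : (m * m * m <= n * n * n)%N by rewrite !leq_mul.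
  have G3 : (n * n * n <= kap.+1 * (n * n * n * J))%N.
    by rewrite mulnCA leq_pmulr // muln_gt0.
  lia.
Qed.

End BivariateEvaluation.

(** The memory is a list of functions, and operands are addressed by their position in it. Ring
    operations on functions are pointwise, so the same instructions are correct at every [s]. *)
Lemma computes_exec (R : comNzRingType) (I : pointedType) c (U V : set (I -> R)) (ms : seq (I -> R)) :
  computes c U V -> 0 \in ms -> 1 \in ms -> (forall z, U z -> z \in ms) ->
  exists (is_ : seq instr) (ms' : seq (I -> R)), [/\ (size is_ <= c)%N,
    forall s : I, exec is_ [seq z s | z <- ms] [seq z s | z <- ms'] &
    forall z, V z -> z \in ms'].
Proof.
move=> H; elim: H ms => {c U V} [c U V VU|c U V a b z Ua Ub zab _ IH] ms m0 m1 Um.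
  exists [::], ms; split=> // [s|z /VU [/Um//|[]->//]]; exact: exec_nil.
have AU t : avail U t -> t \in ms by move=> [/Um//|[]->//].
have [||t [->|/Um Ht]|is_ [ms' [si Hi Vi]]] := IH (rcons ms z).
- by rewrite mem_rcons inE m0 orbT.
- by rewrite mem_rcons inE m1 orbT.
- by rewrite mem_rcons mem_head.
- by rewrite mem_rcons inE Ht orbT.
have [o Ho] : exists o, forall s, op_result o (a s) (b s) (z s).
  by case: zab => [->|[->|->]]; [exists Defs.Add|exists Defs.Sub|exists Defs.Mul].
exists ((o, index a ms, index b ms) :: is_), ms'; split=> // s.
apply: (@exec_cons _ _ _ _ _ _ _ (z s)); rewrite ?size_map ?index_mem ?AU //.
  by rewrite !(nth_map 0) ?index_mem ?AU // !nth_index ?AU.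
by rewrite -map_rcons.
Qed.

Lemma nth_flatten_uniform (T : Type) (x0 : T) n (ss : seq (seq T)) i j :
  all (fun s => size s == n) ss -> (i < size ss)%N -> (j < n)%N ->
  nth x0 (flatten ss) (i * n + j) = nth x0 (nth [::] ss i) j.
Proof.
elim: ss i => [|s ss IH] [|i] //= /andP[/eqP sn Hs] im jn; rewrite nth_cat sn.
  by rewrite jn.
by rewrite mulSn -addnA ltnNge leq_addr /= addKn IH.
Qed.

Lemma size_flatten_uniform (T : Type) n (ss : seq (seq T)) :
  all (fun s => size s == n) ss -> size (flatten ss) = (size ss * n)%N.
Proof.
by elim: ss => //= s ss IH /andP[/eqP sn Hs]; rewrite size_cat sn IH.
Qed.

(** * Layout of the input memory *)

Section Inputs.
Variables (R : comNzRingType) (n : nat) (p : {poly {poly R}}) (pts : (n ^ 2)%N.-tuple (R * R)).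

Let rows_uniform :
  all (fun s => size s == n) [seq [seq p`_i`_j | j <- iota 0 n] | i <- iota 0 n].
Proof. by rewrite all_map; apply/allP => i _ /=; rewrite size_map size_iota. Qed.

Let pairs_uniform : all (fun s => size s == 2) [seq [:: q.1; q.2] | q <- pts].
Proof. by rewrite all_map; apply/allP. Qed.

Lemma size_coefs2 : size (coefs2 n p) = (n * n)%N.
Proof. by rewrite (size_flatten_uniform rows_uniform) size_map size_iota. Qed.

Lemma nth_coefs2 i j : (i < n)%N -> (j < n)%N ->
  (coefs2 n p ++ points2 pts)`_(i * n + j) = p`_i`_j.
Proof.
move=> im jn; rewrite nth_cat size_coefs2 ifT; last first.
  by apply: leq_trans (_ : i.+1 * n <= _)%N; [lia|rewrite leq_mul2r im orbT].
rewrite (nth_flatten_uniform 0 rows_uniform) ?size_map ?size_iota //.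
rewrite (nth_map 0%N) ?size_iota // (nth_map 0%N) ?size_iota //.
by rewrite !nth_iota.
Qed.

Lemma nth_points2 k : (k < n * n)%N ->
  (coefs2 n p ++ points2 pts)`_(n * n + k * 2) = (nth (0, 0) pts k).1 /\
  (coefs2 n p ++ points2 pts)`_(n * n + k * 2 + 1) = (nth (0, 0) pts k).2.
Proof.
move=> kn; have ks : (k < size pts)%N by rewrite size_tuple expnS expn1.
rewrite -addnA !nth_cat size_coefs2 !ltnNge !leq_addr /= !addKn -{1}[(k * 2)%N]addn0.
rewrite !(nth_flatten_uniform 0 pairs_uniform) ?size_map // (nth_map (0, 0)) //.
Qed.

Lemma horner2_sum (x y : R) : (size p <= n)%N -> (sizeY p <= n)%N ->
  p.[x, y] = \sum_(d < n) (\sum_(i < n) p`_i`_d * x ^+ i) * y ^+ d.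
Proof.
move=> sp sY; rewrite (horner_coef_wide _ sp) horner_sum.
under [RHS]eq_bigr do rewrite mulr_suml.
rewrite [RHS]exchange_big; apply: eq_bigr => i _ /=.
rewrite -rmorphXn hornerM hornerC (horner_coef_wide _ (leq_trans (max_size_coefXY _ _) sY)) mulr_suml.
by apply: eq_bigr => d _; rewrite mulrAC.
Qed.

End Inputs.

(** An alias carrying the pointed structure that is required of the domain of a ring of
    functions. *)
Definition assignment (R : comNzRingType) : Type := nat -> R.

HB.instance Definition _ (R : comNzRingType) := gen_eqMixin (assignment R).
HB.instance Definition _ (R : comNzRingType) := gen_choiceMixin (assignment R).
HB.instance Definition _ (R : comNzRingType) := isPointed.Build (assignment R) (fun=> 0).

Lemma bivariate_slp (R : comNzRingType) n kap j : (n <= 2 ^ kap)%N -> (kap.+1 <= 2 ^ j)%N ->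
  exists P : slp, bivariate_multipoint_eval R n P /\
    (op_count P <= 4012 * (kap.+1 * (2 ^ kap * 2 ^ kap * 2 ^ kap * (2 ^ j * j.+1))))%N.
Proof.
move=> nk kj; pose F : comNzRingType := assignment R -> R.
(* The generic input of index [i]: the projection of an assignment to its [i]-th value. *)
pose X i : F := fun s => s i.
pose N := (n * n + n * n * 2)%N.
pose U : set F := vset N X.
pose f d : {poly F} := \poly_(i < n) X (i * n + d)%N.
(* The value 0, which is free, fills the places where the blocks overrun the points. *)
pose x k : F := if (k < n * n)%N then X (n * n + k * 2)%N else 0.
pose y k : F := X (n * n + k * 2 + 1)%N.
pose w k : F := \sum_(d < n) (f d).[x k] * y k ^+ d.
have cw : computes (4012 * (kap.+1 * (2 ^ kap * 2 ^ kap * 2 ^ kap * (2 ^ j * j.+1)))) U (vset (n * n) w).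
  apply: computes_bivariate_eval => //.
  - move=> k; rewrite /x; case: ifP => kn; last exact: availC0.
    by left; apply: vsetP; rewrite /N; lia.
  - by move=> k kn; left; apply: vsetP; rewrite /N; lia.
  - move=> d dn; split; first exact: leq_trans (size_poly _ _) nk.
    move=> z [i _ <-]; rewrite coef_poly; case: ifP => im; last exact: availC0.
    left; apply: vsetP; apply: leq_trans (_ : i.+1 * n <= _)%N; first by lia.
    by apply: leq_trans (leq_addr _ _); rewrite leq_mul2r im orbT.
pose ms := [:: 0, 1 & [seq X i | i <- iota 0 N]].
have [|||is_ [ms' [sis Eis Vms]]] := @computes_exec R _ _ _ _ ms cw.
- by rewrite mem_head.
- by rewrite !inE eqxx orbT.
- move=> z [i /= iN <-]; rewrite !inE; apply/orP; right; apply/orP; right.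
  by apply: map_f; rewrite mem_iota.
exists (Slp is_ [seq index (w k) ms' | k <- iota 0 (n * n)]); split=> // p pts sp sY.
set inp := coefs2 n p ++ points2 pts; pose s := nth 0 inp.
have szp : size pts = (n * n)%N by rewrite size_tuple expnS expn1.
have sinp : size inp = N.
  rewrite size_cat size_coefs2 (size_flatten_uniform (n := 2)) ?size_map ?szp //.
  by rewrite all_map; apply/allP.
exists [seq z s | z <- ms']; split.
- have := Eis s; rewrite /ms /= (_ : [seq z s | z <- _] = inp) //.
  by rewrite -map_comp -[RHS](mkseq_nth 0) sinp.
- rewrite all_map; apply/allP => k; rewrite mem_iota => kn.
  by rewrite /= size_map index_mem; apply: Vms; apply: vsetP.
rewrite /=; apply: (@eq_from_nth _ 0); first by rewrite !size_map size_iota szp.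
rewrite !size_map size_iota => k kn.
rewrite -map_comp (nth_map 0%N) ?size_iota // nth_iota //= add0n.
have wk : w k \in ms' by apply: Vms; apply: vsetP.
rewrite (nth_map 0) ?index_mem // nth_index // (nth_map (0, 0)) ?szp //.
have [E1 E2] := nth_points2 p pts kn.
rewrite (horner2_sum _ _ sp sY) /w fct_sumE; apply: eq_bigr => d _.
have expE (a : F) e : (a ^+ e) s = a s ^+ e.
  by elim: e => [|e IH]; rewrite ?expr0 // !exprS -IH.
rewrite /f horner_poly; set g := (\sum_(i < n) _ : F).
transitivity (g s * (y k ^+ d) s) => //; rewrite expE {}/g fct_sumE; congr (_ * _ ^+ _) => //.
apply: eq_bigr => i _; transitivity (X (i * n + d)%N s * (x k ^+ i) s) => //.
by rewrite expE /x kn; congr (_ * _ ^+ _) => //; apply: nth_coefs2.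
Qed.

(** * The cost in real terms *)

Section RealBound.
Variable K : realType.
Implicit Types x y : K.

Lemma ln2_gt0 : 0 < ln 2 :> K. Proof. by apply: ln_gt0; rewrite ltr1n. Qed.

Lemma log2_le x y : 0 < x -> x <= y -> log2 x <= log2 y.
Proof.
move=> x0 xy; rewrite ler_pM2r ?invr_gt0 ?ln2_gt0 // ler_ln //.
by rewrite posrE (lt_le_trans x0).
Qed.

Lemma log2_gt0 x : 1 < x -> 0 < log2 x.
Proof. by move=> x1; rewrite divr_gt0 ?ln2_gt0 // ln_gt0. Qed.

Lemma log2M x y : 0 < x -> 0 < y -> log2 (x * y) = log2 x + log2 y.
Proof. by move=> x0 y0; rewrite /log2 lnM ?posrE // mulrDl. Qed.

Lemma log2_exp m : log2 (2 ^+ m : K) = m%:R.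
Proof.
by rewrite /log2 lnXn ?ltr0n // -[ln 2 *+ m]mulr_natl mulfK // gt_eqF // ln2_gt0.
Qed.

Lemma log2_nat_ge m a : (2 ^ m <= a)%N -> m%:R <= log2 (a%:R : K).
Proof.
move=> H; rewrite -(log2_exp m); apply: log2_le; first by rewrite exprn_gt0 ?ltr0n.
by rewrite -natrX ler_nat.
Qed.

Lemma log2_3_bounds : 1 < log2 (3 : K) /\ log2 (3 : K) <= 2.
Proof.
split; last by rewrite -(log2_exp 2); apply: log2_le; rewrite ?ltr0n // -natrX ler_nat.
by rewrite /log2 ltr_pdivlMr ?ln2_gt0 // mul1r ltr_ln ?posrE ?ltr0n // ltr_nat.
Qed.

Lemma cost_bound : exists C : K, forall n : nat, (3 <= n)%N ->
  exists kap j, [/\ (n <= 2 ^ kap)%N, (kap.+1 <= 2 ^ j)%N &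
    (4012 * (kap.+1 * (2 ^ kap * 2 ^ kap * 2 ^ kap * (2 ^ j * j.+1))))%:R <=
    C * (n%:R ^+ 3 * log2 (n%:R : K) ^+ 2 * log2 (log2 (n%:R : K)))].
Proof.
have [l31 l32] := log2_3_bounds; set l0 := log2 (log2 (3 : K)).
(* For [n >= 3], the iterated logarithm is at least [l0 > 0], so additive constants can be absorbed
   in it. *)
have l0_gt0 : 0 < l0 by apply: log2_gt0.
(* [144 = 3 * 2^3 * 6] collects [kap + 1 <= 3 L], [2^kap <= 2 n] (three times) and [2^j <= 6 L]; the
   last factor bounds [j + 1]. *)
exists (4012 * 144 * (4 / l0 + 1)) => n n3.
exists (up_log 2 n); set kap := up_log 2 n.
exists (up_log 2 kap.+1); set j := up_log 2 kap.+1.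
have /andP[k1 k2] : (2 ^ kap.-1 < n <= 2 ^ kap)%N by apply: up_log_bounds; lia.
have kap_gt0 : (0 < kap)%N.
  by rewrite lt0n; apply: contraTneq k2 => ->; rewrite expn0 -ltnNge; lia.
have /andP[j1 j2] : (2 ^ j.-1 < kap.+1 <= 2 ^ j)%N by apply: up_log_bounds; lia.
have j_gt0 : (0 < j)%N.
  by rewrite lt0n; apply: contraTneq j2 => ->; rewrite expn0 -ltnNge.
split=> //.
set L := log2 n%:R; set l := log2 L.
have L3 : log2 3 <= L by apply: log2_le; rewrite ?ltr0n // ler_nat.
have L1 : 1 < L by apply: lt_le_trans L3.
have l_l0 : l0 <= l by apply: log2_le => //; apply: lt_trans l31.
have kL : kap.+1%:R <= 3 * L.
  have := log2_nat_ge (ltnW k1); rewrite -/L -{2}(prednK kap_gt0) -!natr1; lra.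
have N2 : (2 ^ kap)%:R <= 2 * n%:R :> K.
  by rewrite -natrM ler_nat -(prednK kap_gt0) expnS leq_mul2l /=; exact: ltnW.
have J6 : (2 ^ j)%:R <= 6 * L.
  have : (2 ^ j)%:R <= 2 * kap.+1%:R :> K.
    by rewrite -natrM ler_nat -(prednK j_gt0) expnS leq_mul2l /=; exact: ltnW.
  by lra.
(* [j - 1 <= log2 (3 L) <= 2 + l], so [j + 1 <= 4 + l], and [4 <= (4 / l0) l]. *)
have jl : j.+1%:R <= (4 / l0 + 1) * l.
  have H1 := log2_nat_ge (ltnW j1).
  have H2 : log2 kap.+1%:R <= log2 (3 * L) by apply: log2_le; rewrite ?ltr0n.
  have H3 : log2 (3 * L) = log2 3 + l by apply: log2M; rewrite ?ltr0n //; lra.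
  have H4 : 4 <= 4 / l0 * l by rewrite mulrAC ler_pdivlMr // ler_pM2l.
  have -> : j.+1%:R = j.-1%:R + 2 :> K by rewrite -natrD addn2 prednK.
  by rewrite mulrDl mul1r; lra.
have n0 : 0 <= n%:R :> K by rewrite ler0n.
rewrite !natrM.
have -> : 4012 * 144 * (4 / l0 + 1) * (n%:R ^+ 3 * L ^+ 2 * l) =
  4012 * ((3 * L) * ((2 * n%:R) * (2 * n%:R) * (2 * n%:R) * ((6 * L) * ((4 / l0 + 1) * l)))).
  by ring.
rewrite ler_pM2l ?ltr0n //.
by do 5 (apply: ler_pM; rewrite ?mulr_ge0 ?ler0n //).
Qed.

End RealBound.

Theorem theorem2p1 (K : realType) :
  exists C : K, forall (R : comNzRingType) (n : nat), (3 <= n)%N ->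
    exists P : slp,
      bivariate_multipoint_eval R n P /\
      (op_count P)%:R <=
        C * (n%:R ^+ 3 * log2 (n%:R : K) ^+ 2 * log2 (log2 (n%:R : K))).
Proof.
have [C HC] := cost_bound K; exists C => R n n3.
have [kap [j [nk kj bound]]] := HC n n3; have [P [evalP costP]] := bivariate_slp R nk kj.
by exists P; split=> //; apply: le_trans bound; rewrite ler_nat.
Qed.
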